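(* Let $D=(0,1)$ and let $\mu$ be Lebesgue measure on $D$. Let $V\in C([0,1])$ satisfy $V>0$ on $D$, and suppose that for some $0\le \alpha'\le\alpha<\infty$ one has $V(x)\asymp x^{\alpha}$ as $x\to0^+$ and $V(x)\asymp(1-x)^{\alpha'}$ as $x\to1^-$. For $\gamma>0$ let $\lambda_0(\gamma)$ be the principal eigenvalue of the operator $L_{\gamma,\mu,V}$ on $D$ with Dirichlet boundary condition, $L_{\gamma,\mu,V}u=-\tfrac12u''-\gamma V\left(\int_D u\,d\mu-u\right)$. Put $\delta(\alpha)=\dfrac{\min(\alpha,1)+1}{\alpha+2}$. Then, as $\gamma\to\infty$, $$\lambda_0(\gamma)\asymp \gamma^{\delta(\alpha)}\times\begin{cases}\dfrac1{\ln\gamma}&\text{if }\alpha=1,\\[1mm]1&\text{if }\alpha\neq1.\end{cases}$$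
   Context: Notation: for functions $f,g$, $f\asymp g$ as $x\to a$ means $0<\liminf_{x\to a}f(x)/g(x)\le\limsup_{x\to a}f(x)/g(x)<\infty$; the same notation is used for functions of $\gamma$ as $\gamma\to\infty$. The operator $-L_{\gamma,\mu,V}$ (with Dirichlet condition on $\partial D=\{0,1\}$) generates the process $X=(X(t))_{t\ge0}$ which is Brownian motion (generator $\tfrac12\frac{d^2}{dx^2}$) killed upon exiting $D$ and which, while in $D$, jumps at spatially dependent rate $\gamma V(X(t))$; at each jump time it is relocated to a point chosen according to $\mu$ (independently of the past), after which it continues in the same way. $P_x^\gamma,E_x^\gamma$ denote probability and expectation for this process started at $x\in D$, and $\tau=\inf\{t>0:X(t)\notin D\}$ is the exit time. The principal eigenvalue $\lambda_0(\gamma)$ has the following known characterizations, valid for any $x\in D$: $\lambda_0(\gamma)=-\lim_{t\to\infty}\frac1t\ln P_x^\gamma(\tau>t)=\sup\{\lambda\in\mathbb R:E_x^\gamma(e^{\lambda\tau})<\infty\}$. *)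

(* Defs.v *)
From Stdlib Require Import Reals.
From Coquelicot Require Import Coquelicot.
Open Scope R_scope.

Definition lim_inf {T : Type} (F : (T -> Prop) -> Prop) (f : T -> R) : Rbar :=
  Rbar_lub (fun l => exists P : T -> Prop,
    F P /\ l = Glb_Rbar (fun y => exists x, P x /\ y = f x)).

Definition lim_sup {T : Type} (F : (T -> Prop) -> Prop) (f : T -> R) : Rbar :=
  Rbar_glb (fun l => exists P : T -> Prop,
    F P /\ l = Lub_Rbar (fun y => exists x, P x /\ y = f x)).

(* f ≍ g along the filter F.  Every use below has g > 0 eventually along F. *)
Definition asymp {T : Type} (F : (T -> Prop) -> Prop) (f g : T -> R) : Prop :=
  Rbar_lt 0 (lim_inf F (fun x => f x / g x)) /\
  Rbar_le (lim_inf F (fun x => f x / g x)) (lim_sup F (fun x => f x / g x)) /\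
  Rbar_lt (lim_sup F (fun x => f x / g x)) p_infty.

Definition in_D (x : R) : Prop := 0 < x < 1.
Definition in_Dbar (x : R) : Prop := 0 <= x <= 1.

(* C^2(D) ∩ C([0,1]) with u = 0 on the boundary of D.  First derivatives are
   required separately because Derive is a total function. *)
Definition dirichlet_dom (u : R -> R) : Prop :=
  continuous_on in_Dbar u /\
  (forall x, in_D x -> ex_derive u x /\ ex_derive (Derive u) x /\
                    continuous (Derive_n u 2) x) /\
  u 0 = 0 /\ u 1 = 0.

(* L_{gamma,mu,V} for mu = Lebesgue measure on D.  Functions in dirichlet_dom
   are continuous on [0,1], so the Riemann integral is the integral
   against mu. *)
Definition Lop (gamma : R) (V u : R -> R) (x : R) : R :=
  - (/ 2) * Derive_n u 2 x - gamma * V x * (RInt u 0 1 - u x).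

(* Complex eigenvalues, for the complex-linear extension of Lop, which has
   real coefficients and so acts on real and imaginary parts separately. *)
Definition is_eigenvalue (gamma : R) (V : R -> R) (nu : C) : Prop :=
  exists u : R -> C,
    dirichlet_dom (fun x => Re (u x)) /\
    dirichlet_dom (fun x => Im (u x)) /\
    (exists x, in_D x /\ u x <> RtoC 0) /\
    forall x, in_D x ->
      (Lop gamma V (fun y => Re (u y)) x, Lop gamma V (fun y => Im (u y)) x)
      = Cmult nu (u x).

(* The Krein-Rutman eigenvalue: it is real, has an eigenfunction positive on D,
   and has the least real part of all eigenvalues.  Minimality makes lambda
   unique. *)
Definition is_principal_eigenvalue (gamma : R) (V : R -> R) (lambda : R)
  : Prop :=
  (exists u : R -> R,
    dirichlet_dom u /\
    (forall x, in_D x -> 0 < u x) /\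
    (forall x, in_D x -> Lop gamma V u x = lambda * u x)) /\
  (forall nu : C, is_eigenvalue gamma V nu -> lambda <= Re nu).

Definition delta (alpha : R) : R := (Rmin alpha 1 + 1) / (alpha + 2).

(* Main.v *)
(* Only the positive eigenfunction [u] matters.  The scale is
   [eps = gamma^(-1/(alpha+2))], the width of the boundary layer at 0, and the
   claim reads [lambda ~ eps / (gamma^-1 * (integral of x^-alpha over (eps,1)))].
   Heuristically [u / int u = 1 - h + lambda g], where [h''/2 = gamma V h] with
   boundary value 1 has mass of order [eps], and [-g''/2 + gamma V g = 1] has
   mass of order [gamma^-1 * (integral of x^-alpha over (eps,1))]; the total mass
   being 1 forces [lambda] to be the ratio of the two masses.  Barta's principle
   makes this rigorous: [lambda] is bounded above and below by means of explicit
   sub- and supersolutions in place of [h] and [g], and since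
   [alpha' <= alpha] the right endpoint never dominates. *)
Require Import Defs.
From Stdlib Require Import Reals Lra Classical.
From Coquelicot Require Import Coquelicot.
Open Scope R_scope.

(** * Two-sided bounds from [asymp]; Barta's principle *)


(** The operator is nonlocal, so touching at an extremum of [u / phi] must control [int u] along
    with [u'']. Barta's principle is therefore normalised by mass: [u <= M * phi] has to imply
    [int u <= M] (or the reverse for the other bound), and the differential inequality for [phi]
    then contains [phi - 1]. Every test function is about 1 in the bulk, loses mass of order [eps]
    in the boundary layer, and carries a corrector of amplitude comparable to [lambda]. For the
    lower bound the mass of the corrector must not exceed the loss; for the upper bound it must make
    up for it. As [gamma^-1 = eps^(alpha+2)], the balance is [lambda ~ 1 / (eps^(alpha+1) * rho
    alpha eps)]. The potential is known only up to constant factors, so the layer equations cannot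
    be solved; the test functions are explicit powers satisfying one-sided inequalities, cut off by
    [Rmax]. The cut-offs may break twice differentiability, hence the smooth functions touching
    [phi] from one side. *)

Lemma asymp_bounds {T : Type} (F : (T -> Prop) -> Prop) {FF : Filter F}
  (f g : T -> R) :
  asymp F f g ->
  (exists c, 0 < c /\ F (fun x => c <= f x / g x)) /\
  (exists C, 0 < C /\ F (fun x => f x / g x <= C)).
Proof.
  intros [Hinf [_ Hsup]]; split.
  - apply NNPP; intros Hn; revert Hinf.
    unfold lim_inf, Rbar_lub; destruct (Rbar_ex_lub _) as [l Hl]; simpl proj1_sig; destruct Hl as [_ Hl].
    apply Rbar_le_not_lt, Hl; intros y [P [FP ->]].
    apply Rbar_not_lt_le; intros Hpos; apply Hn.
    set (E := fun y => exists x, P x /\ y = f x / g x) in Hpos.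
    destruct (Glb_Rbar_correct E) as [Hlb _].
    destruct (Glb_Rbar E) as [c | | ] eqn:HE; simpl in Hpos.
    + exists c; split; [exact Hpos|].
      apply filter_imp with (2 := FP); intros x Px.
      apply (Hlb (f x / g x)); now exists x.
    (* An infinite infimum means that [P] contains no point, so any constant is a bound. *)
    + exists 1; split; [lra|].
      apply filter_imp with (2 := FP); intros x Px.
      destruct (Hlb (f x / g x)); now exists x.
    + easy.
  - apply NNPP; intros Hn; revert Hsup.
    unfold lim_sup, Rbar_glb; destruct (Rbar_ex_glb _) as [l Hl]; simpl proj1_sig; destruct Hl as [_ Hl].
    apply Rbar_le_not_lt, Hl; intros y [P [FP ->]].
    apply Rbar_not_lt_le; intros Hlt; apply Hn.
    set (E := fun y => exists x, P x /\ y = f x / g x) in Hlt.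
    destruct (Lub_Rbar_correct E) as [Hub _].
    destruct (Lub_Rbar E) as [c | | ] eqn:HE; simpl in Hlt.
    + exists (Rmax c 1); split; [apply Rlt_le_trans with (2 := Rmax_r _ _); lra|].
      apply filter_imp with (2 := FP); intros x Px.
      apply Rle_trans with (2 := Rmax_l _ _).
      apply (Hub (f x / g x)); now exists x.
    + easy.
    + exists 1; split; [lra|].
      apply filter_imp with (2 := FP); intros x Px.
      destruct (Hub (f x / g x)); now exists x.
Qed.

Lemma bounds_asymp {T : Type} (F : (T -> Prop) -> Prop) {FF : ProperFilter F}
  (f g : T -> R) (c C : R) :
  0 < c -> F (fun x => c <= f x / g x <= C) -> asymp F f g.
Proof.
  intros Hc HF; repeat split.
  - unfold lim_inf, Rbar_lub; destruct (Rbar_ex_lub _) as [l Hl]; simpl proj1_sig; destruct Hl as [Hl _].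
    apply Rbar_lt_le_trans with c; [exact Hc|].
    eapply Rbar_le_trans; [|apply Hl; eexists; split; [exact HF|reflexivity]].
    apply Glb_Rbar_correct; intros y [x [Hx ->]]; apply Hx.
  - unfold lim_inf, Rbar_lub; destruct (Rbar_ex_lub _) as [l Hl].
    unfold lim_sup, Rbar_glb; destruct (Rbar_ex_glb _) as [m Hm]; simpl proj1_sig.
    destruct Hl as [_ Hl]; destruct Hm as [_ Hm].
    apply Hl; intros y [P [FP ->]]; apply Hm; intros z [Q [FQ ->]].
    destruct (Hierarchy.filter_ex _ (filter_and _ _ FP FQ)) as [x [Px Qx]].
    apply Rbar_le_trans with (f x / g x).
    + apply Glb_Rbar_correct; now exists x.
    + apply Lub_Rbar_correct; now exists x.
  - unfold lim_sup, Rbar_glb; destruct (Rbar_ex_glb _) as [l Hl]; simpl proj1_sig; destruct Hl as [Hl _].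
    apply Rbar_le_lt_trans with C; [|exact I].
    eapply Rbar_le_trans; [apply Hl; eexists; split; [exact HF|reflexivity]|].
    apply Lub_Rbar_correct; intros y [x [Hx ->]]; apply Hx.
Qed.

Lemma locally_in_D (x : R) : in_D x -> locally x in_D.
Proof.
  intros [H0 H1].
  assert (He : 0 < Rmin x (1 - x)) by (apply Rmin_pos; lra).
  exists (mkposreal _ He); intros y Hy.
  apply Rabs_lt_between' in Hy; simpl in Hy.
  pose proof (Rmin_l x (1 - x)); pose proof (Rmin_r x (1 - x)).
  split; lra.
Qed.

Lemma second_derivative_at_min (f f' : R -> R) (f2 x : R) :
  locally x (fun y => is_derive f y (f' y)) -> is_derive f' x f2 ->
  locally x (fun y => f x <= f y) -> 0 <= f2.
Proof.
  intros [d1 Hd] Hf2 [d2 Hmin].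
  apply Rnot_lt_le; intros Hneg.
  assert (Hf'x : f' x = 0).
  { assert (Hx : is_derive f x (f' x)) by (apply Hd, ball_center).
    apply is_derive_Reals in Hx.
    rewrite <- (proj2 (derive_pt_eq f x (f' x) (exist _ (f' x) Hx)) Hx).
    apply deriv_minimum with (x - d2) (x + d2); try (pose proof (cond_pos d2); lra).
    intros y Hy Hy'; apply Hmin, Rabs_lt_between'; lra. }
  apply is_derive_Reals in Hf2.
  destruct (Hf2 (- f2 / 2)) as [d3 Hd3]; [lra|].
  set (r := Rmin (d1 / 2) (Rmin (d2 / 2) (d3 / 2))).
  assert (Hr : 0 < r /\ r < d1 /\ r < d2 /\ r < d3).
  { pose proof (cond_pos d1); pose proof (cond_pos d2); pose proof (cond_pos d3).
    unfold r; pose proof (Rmin_l (d1 / 2) (Rmin (d2 / 2) (d3 / 2))).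
    pose proof (Rmin_r (d1 / 2) (Rmin (d2 / 2) (d3 / 2))).
    pose proof (Rmin_l (d2 / 2) (d3 / 2)); pose proof (Rmin_r (d2 / 2) (d3 / 2)).
    repeat split; try lra; repeat apply Rmin_pos; lra. }
  (* Compare with a parabola of half the curvature: right of [x], [f'] lies below
     [f2 / 2 * (y - x)], so the mean value theorem gives [f (x + r) - f x <= f2 / 4 * r^2 < 0],
     against minimality. *)
  destruct (MVT_gen (fun y => f y - f2 / 4 * (y - x) ^ 2) x (x + r)
    (fun y => f' y - f2 / 2 * (y - x))) as [c [Hc Heq]].
  - intros y; rewrite Rmin_left, Rmax_right by lra; intros Hy.
    apply (is_derive_minus f); [apply Hd, Rabs_lt_between'; lra|].
    auto_derive; [easy|field].
  - intros y; rewrite Rmin_left, Rmax_right by lra; intros Hy.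
    apply continuity_pt_minus.
    + apply continuity_pt_filterlim, (ex_derive_continuous f).
      exists (f' y); apply Hd, Rabs_lt_between'; lra.
    + apply continuity_pt_filterlim, (ex_derive_continuous (fun y => f2 / 4 * (y - x) ^ 2)).
      auto_derive; easy.
  - rewrite Rmin_left, Rmax_right in Hc by lra.
    assert (Hfc : f' c - f2 / 2 * (c - x) <= 0).
    { destruct (Req_dec c x) as [->|Hne]; [rewrite Hf'x; lra|].
      specialize (Hd3 (c - x)); rewrite Hf'x in Hd3.
      replace (x + (c - x)) with c in Hd3 by ring.
      assert (Hlt : Rabs ((f' c - 0) / (c - x) - f2) < - f2 / 2).
      { apply Hd3; [lra|rewrite Rabs_right; lra]. }
      apply Rabs_lt_between in Hlt.
      assert (Hq : (f' c - 0) / (c - x) < f2 / 2) by lra.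
      apply (Rmult_lt_compat_r (c - x)) in Hq; [|lra].
      unfold Rdiv in Hq at 1; rewrite Rmult_assoc, Rinv_l in Hq; lra. }
    assert (Hle : f x <= f (x + r)) by (apply Hmin, Rabs_lt_between'; lra).
    assert (Hr2 : 0 < r ^ 2) by (apply pow_lt; lra).
    replace (x + r - x) with r in Heq by ring.
    replace (x - x) with 0 in Heq by ring.
    assert ((f' c - f2 / 2 * (c - x)) * r <= 0) by nra.
    nra.
Qed.

(** A relation instead of [Derive_n]: the first derivative is supplied as a formula, and only near
    [x], because the test functions are singular at the endpoints. *)
Definition derive2_at (p : R -> R) (x p2 : R) : Prop :=
  exists p' : R -> R,
    locally x (fun y => is_derive p y (p' y)) /\ is_derive p' x p2.

Lemma derive2_at_le (p q : R -> R) (x p2 q2 : R) :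
  derive2_at p x p2 -> derive2_at q x q2 ->
  locally x (fun y => p y <= q y) -> p x = q x -> p2 <= q2.
Proof.
  intros [p' [Hp Hp']] [q' [Hq Hq']] Hle Heq.
  apply Rminus_le_0.
  apply second_derivative_at_min with (fun y => q y - p y) (fun y => q' y - p' y) x.
  - apply filter_imp with (2 := filter_and _ _ Hp Hq); intros y [Hy1 Hy2].
    now apply (is_derive_minus q p).
  - now apply (is_derive_minus q' p').
  - apply filter_imp with (2 := Hle); intros y Hy; lra.
Qed.

Lemma derive2_at_scal (p : R -> R) (x p2 M : R) :
  derive2_at p x p2 -> derive2_at (fun y => M * p y) x (M * p2).
Proof.
  intros [p' [Hp Hp']]; exists (fun y => M * p' y); split.
  - apply filter_imp with (2 := Hp); intros y Hy; now apply (is_derive_scal p).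
  - now apply (is_derive_scal p').
Qed.

Definition positive_eigenfunction (gamma : R) (V : R -> R) (lambda : R)
  (u : R -> R) : Prop :=
  dirichlet_dom u /\ (forall x, in_D x -> 0 < u x) /\
  (forall x, in_D x -> Lop gamma V u x = lambda * u x).

Lemma dirichlet_dom_derive2_at (u : R -> R) (x : R) :
  dirichlet_dom u -> in_D x -> derive2_at u x (Derive_n u 2 x).
Proof.
  intros [_ [Hd _]] Hx; exists (Derive u); split.
  - apply filter_imp with (2 := locally_in_D x Hx).
    intros y Hy; apply Derive_correct, Hd, Hy.
  - apply (Derive_correct (Derive u)), Hd, Hx.
Qed.

(** The retraction of the line onto [0,1]. Composing with it turns continuity relative to [0,1] into
    continuity at every point, as the extreme value and integrability theorems require. *)
Definition clamp (x : R) : R := Rmax 0 (Rmin 1 x).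

Lemma clamp_in_Dbar (x : R) : in_Dbar (clamp x).
Proof.
  unfold clamp, in_Dbar; split; [apply Rmax_l|].
  apply Rmax_lub; [lra|apply Rmin_l].
Qed.

Lemma clamp_id (x : R) : in_Dbar x -> clamp x = x.
Proof.
  intros [H0 H1]; unfold clamp.
  rewrite Rmin_right by lra; now rewrite Rmax_right by lra.
Qed.

Lemma continuous_clamp (u : R -> R) (x : R) :
  continuous_on in_Dbar u -> continuous (fun y => u (clamp y)) x.
Proof.
  intros Hu.
  apply (filterlim_comp _ _ _ clamp u _ (within in_Dbar (locally (clamp x)))).
  2: apply Hu, clamp_in_Dbar.
  intros P [d Hd]; exists d; intros y Hy.
  apply Hd; [|apply clamp_in_Dbar].
  apply Rle_lt_trans with (2 := Hy).
  unfold clamp, abs, minus, plus, opp; simpl.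
  unfold Rmax, Rmin; repeat destruct Rle_dec; unfold Rabs;
    repeat destruct Rcase_abs; lra.
Qed.

Lemma ex_RInt_continuous_on (u : R -> R) (a b : R) :
  continuous_on in_Dbar u -> 0 <= a <= b -> b <= 1 -> ex_RInt u a b.
Proof.
  intros Hu Ha Hb.
  apply ex_RInt_ext with (fun y => u (clamp y)).
  - intros x; rewrite Rmin_left, Rmax_right by lra; intros Hx.
    rewrite clamp_id; [easy|split; lra].
  - apply (ex_RInt_continuous (fun y => u (clamp y))); intros z _; now apply continuous_clamp.
Qed.

Lemma derive2_at_continuous (p : R -> R) (x p2 : R) :
  derive2_at p x p2 -> continuous p x.
Proof.
  intros [p' [Hp _]]; apply (ex_derive_continuous p).
  exists (p' x); now apply locally_singleton in Hp.
Qed.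

(* Barta's principle: at a maximum point of [u / phi] the operator can be
   compared through the second derivative of a function touching [phi] from
   above, so that [phi] may have concave kinks. *)
Lemma barta_lower (gamma c lambda : R) (V u phi : R -> R) :
  0 < gamma -> (forall x, in_D x -> 0 < V x) ->
  positive_eigenfunction gamma V lambda u ->
  (forall x, in_Dbar x -> continuous phi x /\ 0 < phi x) ->
  (forall M, 0 < M -> (forall x, in_D x -> u x <= M * phi x) -> RInt u 0 1 <= M) ->
  (forall x, in_D x -> exists p p2, derive2_at p x p2 /\ p x = phi x /\
     locally x (fun y => phi y <= p y) /\
     c * phi x <= - / 2 * p2 + gamma * V x * (phi x - 1)) ->
  c <= lambda.
Proof.
  intros Hg HV [Hdom [Hpos Heig]] Hphi HM Htouch.
  pose proof Hdom as [Hcont [_ [Hu0 Hu1]]].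
  destruct (continuity_ab_maj (fun x => u (clamp x) / phi x) 0 1) as [x0 [Hmax Hx0]].
  - lra.
  - intros x Hx; apply continuity_pt_div.
    + apply continuity_pt_filterlim, (continuous_clamp u x Hcont).
    + apply continuity_pt_filterlim, Hphi, Hx.
    + apply Rgt_not_eq, Hphi, Hx.
  - assert (Hmax' : forall x, in_Dbar x -> u x / phi x <= u x0 / phi x0).
    { intros x Hx; rewrite <- (clamp_id x Hx) at 1; rewrite <- (clamp_id x0 Hx0) at 1.
      now apply Hmax. }
    clear Hmax; set (M := u x0 / phi x0) in *.
    assert (HMpos : 0 < M).
    { assert (Hh : in_Dbar (/ 2)) by (split; lra).
      apply Rlt_le_trans with (2 := Hmax' _ Hh).
      apply Rdiv_lt_0_compat; [apply Hpos; split; lra|now apply Hphi]. }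
    (* [u] vanishes at both ends while [phi] is positive there, so a positive maximum of the
       quotient is interior. *)
    assert (Hx0D : in_D x0).
    { destruct Hx0 as [H0 H1]; split.
      - destruct H0 as [H0| <-]; [exact H0|].
        unfold M in HMpos; rewrite Hu0 in HMpos; unfold Rdiv in HMpos; lra.
      - destruct H1 as [H1| ->]; [exact H1|].
        unfold M in HMpos; rewrite Hu1 in HMpos; unfold Rdiv in HMpos; lra. }
    assert (Hle : forall x, in_D x -> u x <= M * phi x).
    { intros x Hx; assert (Hx' : in_Dbar x) by (split; apply Rlt_le, Hx).
      apply Rle_div_l; [now apply Hphi|now apply Hmax']. }
    assert (Heq : u x0 = M * phi x0).
    { unfold M; field; apply Rgt_not_eq; now apply Hphi. }
    destruct (Htouch x0 Hx0D) as [p [p2 [Hp [Hpx [Hpl Hineq]]]]].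
    assert (H2 : Derive_n u 2 x0 <= M * p2).
    { apply derive2_at_le with u (fun y => M * p y) x0.
      - now apply dirichlet_dom_derive2_at.
      - now apply derive2_at_scal.
      - apply filter_imp with (2 := filter_and _ _ Hpl (locally_in_D x0 Hx0D)).
        intros y [Hy HyD]; apply Rle_trans with (1 := Hle y HyD).
        apply Rmult_le_compat_l; [now left|exact Hy].
      - now rewrite Hpx. }
    (* The nonlocal term: the mass condition replaces [int u] by [M], which produces the 1 in
       [phi x - 1]. *)
    assert (HI := HM M HMpos Hle).
    assert (HgV : 0 < gamma * V x0) by (apply Rmult_lt_0_compat; [easy|now apply HV]).
    assert (Hphi0 : 0 < u x0) by now apply Hpos.
    assert (He := Heig x0 Hx0D); unfold Lop in He.
    assert (HI' : gamma * V x0 * RInt u 0 1 <= gamma * V x0 * M)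
      by (apply Rmult_le_compat_l; lra).
    apply (Rmult_le_compat_l M) in Hineq; [|lra].
    apply Rmult_le_reg_r with (1 := Hphi0).
    rewrite <- He.
    replace (c * u x0) with (M * (c * phi x0)) by (rewrite Heq; ring).
    apply Rle_trans with (1 := Hineq).
    replace (gamma * V x0 * (RInt u 0 1 - u x0)) with
      (gamma * V x0 * RInt u 0 1 - gamma * V x0 * (M * phi x0)) by (rewrite <- Heq; ring).
    lra.
Qed.

(* The same principle at a maximum point of [phi / u]; only the positive part of
   [phi] matters, and convex kinks are allowed. *)
Lemma barta_upper (gamma c lambda a b : R) (V u phi : R -> R) :
  0 < gamma -> (forall x, in_D x -> 0 < V x) ->
  positive_eigenfunction gamma V lambda u ->
  0 < a < b -> b < 1 ->
  (forall x, a <= x <= b -> continuous phi x) ->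
  (forall x, in_D x -> x < a \/ b < x -> phi x <= 0) ->
  (exists x, in_D x /\ 0 < phi x) ->
  (forall M, 0 < M -> (forall x, in_D x -> phi x <= M * u x) -> 1 <= M * RInt u 0 1) ->
  (forall x, in_D x -> 0 < phi x -> exists p p2, derive2_at p x p2 /\ p x = phi x /\
     locally x (fun y => p y <= phi y) /\
     - / 2 * p2 + gamma * V x * (phi x - 1) <= c * phi x) ->
  lambda <= c.
Proof.
  intros Hg HV [Hdom [Hpos Heig]] Hab Hb Hcphi Hout [x1 [Hx1 Hx1pos]] HM Htouch.
  assert (HD : forall x, a <= x <= b -> in_D x) by (intros x Hx; split; lra).
  (* Near the endpoints [u] tends to 0 and [phi / u] is out of control; since [phi <= 0] off [a,b],
     a maximum over this compact subset of [D] is global where it matters. *)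
  destruct (continuity_ab_maj (fun x => phi x / u x) a b) as [x0 [Hmax Hx0]].
  - lra.
  - intros x Hx; apply continuity_pt_div.
    + apply continuity_pt_filterlim, (Hcphi x Hx).
    + apply continuity_pt_filterlim.
      apply (derive2_at_continuous u x (Derive_n u 2 x)).
      now apply dirichlet_dom_derive2_at, HD.
    + now apply Rgt_not_eq, Hpos, HD.
  - set (M := phi x0 / u x0) in *.
    assert (HMpos : 0 < M).
    { assert (Hin : a <= x1 <= b).
      { apply NNPP; intros Hn.
        assert (phi x1 <= 0) by (apply Hout; [easy|lra]); lra. }
      apply Rlt_le_trans with (2 := Hmax _ Hin).
      apply Rdiv_lt_0_compat; [easy|now apply Hpos]. }
    assert (Hle : forall x, in_D x -> phi x <= M * u x).
    { intros x Hx; assert (Hux := Hpos x Hx).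
      destruct (classic (a <= x <= b)) as [Hi|Hi].
      - apply Rle_div_l; [easy|now apply Hmax].
      - apply Rle_trans with 0; [apply Hout; [easy|lra]|].
        apply Rmult_le_pos; lra. }
    assert (Hx0D : in_D x0) by now apply HD.
    assert (Hu0 : 0 < u x0) by now apply Hpos.
    assert (Heq : phi x0 = M * u x0) by (unfold M; field; lra).
    assert (Hphi0 : 0 < phi x0) by (rewrite Heq; now apply Rmult_lt_0_compat).
    destruct (Htouch x0 Hx0D Hphi0) as [p [p2 [Hp [Hpx [Hpl Hineq]]]]].
    assert (H2 : p2 <= M * Derive_n u 2 x0).
    { apply derive2_at_le with p (fun y => M * u y) x0.
      - easy.
      - now apply derive2_at_scal, dirichlet_dom_derive2_at.
      - apply filter_imp with (2 := filter_and _ _ Hpl (locally_in_D x0 Hx0D)).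
        intros y [Hy HyD]; apply Rle_trans with (1 := Hy); now apply Hle.
      - now rewrite Hpx. }
    assert (HI := HM M HMpos Hle).
    assert (HgV : 0 < gamma * V x0) by (apply Rmult_lt_0_compat; [easy|now apply HV]).
    assert (He := Heig x0 Hx0D); unfold Lop in He.
    assert (HI' : gamma * V x0 * 1 <= gamma * V x0 * (M * RInt u 0 1))
      by (apply Rmult_le_compat_l; lra).
    assert (HE : lambda * phi x0 =
      - / 2 * (M * Derive_n u 2 x0) - gamma * V x0 * (M * RInt u 0 1) +
        gamma * V x0 * phi x0).
    { rewrite Heq; replace (lambda * (M * u x0)) with (M * (lambda * u x0)) by ring.
      rewrite <- He; ring. }
    apply Rmult_le_reg_r with (1 := Hphi0).
    lra.
Qed.

(** * Powers of [x] and the potential *)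


Lemma Rpower_pos (x a : R) : 0 < Rpower x a.
Proof. apply exp_pos. Qed.

Lemma Rpower_1_base (a : R) : Rpower 1 a = 1.
Proof. unfold Rpower; now rewrite ln_1, Rmult_0_r, exp_0. Qed.

Lemma Rpower_le_1 (x a : R) : 0 <= a -> 0 < x <= 1 -> Rpower x a <= 1.
Proof. intros Ha Hx; rewrite <- (Rpower_1_base a); now apply Rle_Rpower_l. Qed.

Lemma Rpower_ge_1 (x a : R) : 0 <= a -> 1 <= x -> 1 <= Rpower x a.
Proof.
  intros Ha Hx; rewrite <- (Rpower_1_base a); apply Rle_Rpower_l; [easy|lra].
Qed.

Lemma Rpower_opp_antitone (x y a : R) :
  0 <= a -> 0 < x <= y -> Rpower y (- a) <= Rpower x (- a).
Proof.
  intros Ha Hxy; rewrite 2!Rpower_Ropp.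
  apply Rinv_le_contravar; [apply Rpower_pos|now apply Rle_Rpower_l].
Qed.

Lemma Rpower_antitone_exp (x a b : R) :
  0 < x <= 1 -> a <= b -> Rpower x b <= Rpower x a.
Proof.
  intros Hx Hab; replace b with (a + (b - a)) by ring; rewrite Rpower_plus.
  rewrite <- (Rmult_1_r (Rpower x a)) at 2.
  apply Rmult_le_compat_l; [left; apply Rpower_pos|apply Rpower_le_1; lra].
Qed.

Lemma is_derive_Rpower (x a : R) :
  0 < x -> is_derive (fun y => Rpower y a) x (a * Rpower x a / x).
Proof.
  intros Hx; unfold Rpower; auto_derive; [easy|field; lra].
Qed.

(** An antiderivative of [x^(-alpha)], of which only increments matter. Its exceptional case is the
    source of the logarithm in the rate. *)
Definition prim (alpha x : R) : R :=
  if Req_EM_T alpha 1 then ln x else Rpower x (1 - alpha) / (1 - alpha).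

Lemma is_derive_prim (alpha x : R) :
  0 < x -> is_derive (prim alpha) x (Rpower x (- alpha)).
Proof.
  intros Hx; unfold prim; destruct (Req_EM_T alpha 1) as [->|Hne].
  - rewrite Rpower_Ropp, Rpower_1 by easy; now apply is_derive_ln.
  - unfold Rpower; auto_derive; [easy|].
    replace ((1 - alpha) * ln x) with (ln x + - alpha * ln x) by ring.
    rewrite exp_plus, exp_ln by easy; field; split; lra.
Qed.

Lemma prim_increment (alpha x y : R) :
  0 <= alpha -> 0 < x <= y ->
  (y - x) * Rpower y (- alpha) <= prim alpha y - prim alpha x.
Proof.
  intros Ha Hxy.
  destruct (MVT_gen (prim alpha) x y (fun z => Rpower z (- alpha))) as [z [Hz ->]].
  - intros z; rewrite Rmin_left, Rmax_right by lra; intros Hz.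
    apply is_derive_prim; lra.
  - intros z; rewrite Rmin_left, Rmax_right by lra; intros Hz.
    apply continuity_pt_filterlim, (ex_derive_continuous (prim alpha)).
    exists (Rpower z (- alpha)); apply is_derive_prim; lra.
  - rewrite Rmin_left, Rmax_right in Hz by lra.
    rewrite (Rmult_comm (y - x)).
    apply Rmult_le_compat_r; [lra|apply Rpower_opp_antitone; lra].
Qed.

(* Order of magnitude of the integral of [x^-alpha] over [(eps, 1)]. *)
Definition rho (alpha eps : R) : R :=
  match total_order_T alpha 1 with
  | inleft (left _) => 1
  | inleft (right _) => - ln eps
  | inright _ => Rpower eps (1 - alpha)
  end.

Lemma ln_opp_ge_1 (eps : R) : 0 < eps <= exp (-1) -> 1 <= - ln eps.
Proof.
  intros [H0 H1]; assert (Hl := ln_le _ _ H0 H1); rewrite ln_exp in Hl; lra.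
Qed.

Lemma exp_m1_lt_1 : exp (-1) < 1.
Proof. rewrite <- exp_0; apply exp_increasing; lra. Qed.

(** Multiplied by [eps^(alpha+1)] this gives [eps^2 <= eps^(alpha+1) * rho alpha eps]: the expected
    eigenvalue is at most of order [eps^-2], which keeps the corrector of the lower bound bounded.
    The threshold [exp (-1)] makes [- ln eps] at least 1. *)
Lemma rho_ge (alpha eps : R) :
  0 < eps <= exp (-1) -> Rpower eps (1 - alpha) <= rho alpha eps.
Proof.
  intros He; pose proof exp_m1_lt_1; unfold rho.
  destruct (total_order_T alpha 1) as [[Hlt|Heq]|Hgt].
  - apply Rpower_le_1; lra.
  - subst; rewrite Rminus_diag, Rpower_O by easy; now apply ln_opp_ge_1.
  - lra.
Qed.

Lemma rho_pos (alpha eps : R) : 0 < eps <= exp (-1) -> 0 < rho alpha eps.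
Proof.
  intros He; apply Rlt_le_trans with (2 := rho_ge alpha eps He); apply Rpower_pos.
Qed.

(** The left side is the integral of [(K * eps + x)^(-alpha)] over (0,1), which bounds the corrector
    mass in the lower bound. *)
Lemma prim_increment_le_rho (alpha K : R) :
  0 <= alpha -> 1 <= K -> exists C, 0 < C /\ forall eps, 0 < eps <= exp (-1) -> K * eps <= 1 ->
  prim alpha (1 + K * eps) - prim alpha (K * eps) <= C * rho alpha eps.
Proof.
  intros Ha HK; unfold prim, rho.
  destruct (total_order_T alpha 1) as [[Hlt|Heq]|Hgt].
  - exists (Rpower 2 (1 - alpha) / (1 - alpha)).
    assert (H0 : 0 < / (1 - alpha)) by (apply Rinv_0_lt_compat; lra).
    split; [apply Rdiv_lt_0_compat; [apply Rpower_pos|lra]|intros eps He HKe].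
    destruct (Req_EM_T alpha 1); [lra|].
    rewrite Rmult_1_r; unfold Rdiv; rewrite <- Rmult_minus_distr_r.
    apply Rmult_le_compat_r; [lra|].
    pose proof (Rpower_pos (K * eps) (1 - alpha)).
    assert (Rpower (1 + K * eps) (1 - alpha) <= Rpower 2 (1 - alpha)).
    { apply Rle_Rpower_l; [lra|split; nra]. }
    lra.
  - exists 2; split; [lra|intros eps He HKe].
    destruct (Req_EM_T alpha 1); [|lra].
    rewrite ln_mult by lra.
    assert (Hl := ln_opp_ge_1 eps He).
    assert (0 <= ln K) by (rewrite <- ln_1; apply ln_le; lra).
    assert (ln (1 + K * eps) <= 1).
    { apply Rle_trans with (ln (exp 1)); [apply ln_le|rewrite ln_exp; lra].
      - assert (0 < K * eps) by (apply Rmult_lt_0_compat; lra); lra.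
      - assert (1 + 1 < exp 1) by (apply exp_ineq1; lra); lra. }
    lra.
  - exists (/ (alpha - 1)); split; [apply Rinv_0_lt_compat; lra|intros eps He HKe].
    destruct (Req_EM_T alpha 1); [lra|].
    replace (1 - alpha) with (- (alpha - 1)) by ring.
    assert (H0 : 0 < / (alpha - 1)) by (apply Rinv_0_lt_compat; lra).
    replace (/ - (alpha - 1)) with (- / (alpha - 1)) by (field; lra).
    assert (Rpower (K * eps) (- (alpha - 1)) <= Rpower eps (- (alpha - 1))).
    { apply Rpower_opp_antitone; [lra|split; nra]. }
    pose proof (Rpower_pos (1 + K * eps) (- (alpha - 1))).
    replace (Rpower (1 + K * eps) (- (alpha - 1)) / - (alpha - 1) -
             Rpower (K * eps) (- (alpha - 1)) / - (alpha - 1)) with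
      (/ (alpha - 1) * (Rpower (K * eps) (- (alpha - 1)) -
                        Rpower (1 + K * eps) (- (alpha - 1)))) by (field; lra).
    apply Rmult_le_compat_l; lra.
Qed.

(** Guarantees that the corrector of the upper bound, living on [(k * eps, b)] with fixed [b], still
    has mass of the full order [rho]. *)
Lemma prim_increment_ge_rho (alpha k b : R) :
  0 <= alpha -> 0 < k -> 0 < b <= 1 ->
  exists c eps0, 0 < c /\ 0 < eps0 /\ forall eps, 0 < eps < eps0 ->
  c * rho alpha eps <= prim alpha b - prim alpha (k * eps).
Proof.
  intros Ha Hk Hb; unfold rho.
  destruct (total_order_T alpha 1) as [[Hlt|Heq]|Hgt].
  - exists (b / 2), (b / (2 * k)); split; [lra|split].
    + apply Rdiv_lt_0_compat; lra.
    + intros eps [He1 He2].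
      apply Rlt_div_r in He2; [|lra].
      apply Rle_trans with (2 := prim_increment alpha (k * eps) b Ha ltac:(split; nra)).
      assert (1 <= Rpower b (- alpha)).
      { rewrite <- (Rpower_1_base (- alpha)); apply Rpower_opp_antitone; lra. }
      nra.
  (* Below [(b / k)^2] one has [ln (b / k) >= / 2 * ln eps], so half of [- ln eps] survives. *)
  - exists (/ 2), ((b / k) * (b / k)); assert (Hbk : 0 < b / k) by (apply Rdiv_lt_0_compat; lra).
    split; [lra|split].
    + nra.
    + intros eps [He1 He2]; unfold prim.
      destruct (Req_EM_T alpha 1); [|lra].
      rewrite ln_mult by lra.
      assert (Hl : ln eps < ln (b / k * (b / k))) by (apply ln_increasing; lra).
      rewrite ln_mult, ln_div in Hl by lra; lra.
  (* For [alpha > 1] the mass sits at the lower end: the interval [(k * eps, 2 * k * eps)] alone has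
     the right order. *)
  - exists (k * Rpower (2 * k) (- alpha)), (b / (2 * k)).
    pose proof (Rpower_pos (2 * k) (- alpha)).
    split; [nra|split].
    + apply Rdiv_lt_0_compat; lra.
    + intros eps [He1 He2].
      apply Rlt_div_r in He2; [|lra].
      assert (H1 := prim_increment alpha (k * eps) (2 * k * eps) Ha ltac:(split; nra)).
      assert (H2 := prim_increment alpha (2 * k * eps) b Ha ltac:(split; nra)).
      pose proof (Rpower_pos b (- alpha)).
      assert (H3 : 0 <= (b - 2 * k * eps) * Rpower b (- alpha)) by (apply Rmult_le_pos; nra).
      replace (1 - alpha) with (1 + - alpha) by ring.
      rewrite Rpower_plus, Rpower_1 by easy.
      rewrite <- (Rpower_mult_distr (2 * k) eps) in H1 by lra.
      lra.
Qed.

Lemma positive_on_compact (V : R -> R) (a b : R) :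
  continuous_on in_Dbar V -> (forall x, in_D x -> 0 < V x) -> 0 < a <= b -> b < 1 ->
  exists m, 0 < m /\ forall x, a <= x <= b -> m <= V x.
Proof.
  intros HV Hpos Hab Hb.
  destruct (continuity_ab_min (fun x => V (clamp x)) a b) as [x0 [Hmin Hx0]].
  - lra.
  - intros x _; apply continuity_pt_filterlim, (continuous_clamp V x HV).
  - exists (V (clamp x0)); split.
    + apply Hpos; rewrite clamp_id; split; lra.
    + intros x Hx; rewrite <- (clamp_id x) by (split; lra); now apply Hmin.
Qed.

Lemma bounded_on_Dbar (V : R -> R) :
  continuous_on in_Dbar V -> exists M, 0 < M /\ forall x, in_D x -> V x <= M.
Proof.
  intros HV.
  destruct (continuity_ab_maj (fun x => V (clamp x)) 0 1) as [x0 [Hmax Hx0]].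
  - lra.
  - intros x _; apply continuity_pt_filterlim, (continuous_clamp V x HV).
  - exists (Rmax 1 (V (clamp x0))); split.
    + apply Rlt_le_trans with (2 := Rmax_l _ _); lra.
    + intros x Hx; rewrite <- (clamp_id x) by (destruct Hx; split; lra).
      apply Rle_trans with (2 := Rmax_r _ _), Hmax; destruct Hx; lra.
Qed.

(** Since [(1 - x)^alpha <= (1 - x)^alpha'], the right end may be treated with the exponent [alpha]
    too, so one lower estimate serves both ends. Away from the ends compactness gives the
    constants. *)
Lemma potential_bounds (V : R -> R) (alpha alpha' : R) :
  continuous_on in_Dbar V -> (forall x, in_D x -> 0 < V x) -> 0 <= alpha' <= alpha ->
  asymp (at_right 0) V (fun x => Rpower x alpha) ->
  asymp (at_left 1) V (fun x => Rpower (1 - x) alpha') ->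
  exists c1 c2, 0 < c1 /\ 0 < c2 /\
    (forall x, 0 < x <= / 2 -> c1 * Rpower x alpha <= V x) /\
    (forall x, / 2 <= x < 1 -> c1 * Rpower (1 - x) alpha <= V x) /\
    (forall x, in_D x -> V x <= c2 * Rpower x alpha).
Proof.
  intros HV Hpos Ha H0 H1.
  destruct (asymp_bounds _ _ _ H0) as [[c [Hc [d1 Hd1]]] [C [HC [d2 Hd2]]]].
  destruct (asymp_bounds _ _ _ H1) as [[c' [Hc' [d3 Hd3]]] _].
  set (d := Rmin (/ 2) (Rmin d1 (Rmin d2 d3))).
  assert (Hd : 0 < d /\ d <= / 2 /\ d <= d1 /\ d <= d2 /\ d <= d3).
  { pose proof (cond_pos d1); pose proof (cond_pos d2); pose proof (cond_pos d3).
    unfold d; pose proof (Rmin_l (/ 2) (Rmin d1 (Rmin d2 d3))).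
    pose proof (Rmin_r (/ 2) (Rmin d1 (Rmin d2 d3))).
    pose proof (Rmin_l d1 (Rmin d2 d3)); pose proof (Rmin_r d1 (Rmin d2 d3)).
    pose proof (Rmin_l d2 d3); pose proof (Rmin_r d2 d3).
    repeat split; try lra; repeat apply Rmin_pos; lra. }
  clearbody d.
  destruct (positive_on_compact V (d / 2) (1 - d / 2) HV Hpos) as [m [Hm HmV]]; [lra|lra|].
  destruct (bounded_on_Dbar V HV) as [M [HM HMV]].
  assert (Hc1 : 0 < Rmin m (Rmin c c')) by (repeat apply Rmin_pos; lra).
  assert (Hc1m : Rmin m (Rmin c c') <= m) by apply Rmin_l.
  assert (Hc1c : Rmin m (Rmin c c') <= c)
    by (apply Rle_trans with (1 := Rmin_r _ _), Rmin_l).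
  assert (Hc1c' : Rmin m (Rmin c c') <= c')
    by (apply Rle_trans with (1 := Rmin_r _ _), Rmin_r).
  set (c1 := Rmin m (Rmin c c')) in *; clearbody c1.
  assert (Hp := Rpower_pos (d / 2) alpha).
  exists c1, (Rmax C (M / Rpower (d / 2) alpha)); repeat split.
  - exact Hc1.
  - apply Rlt_le_trans with (2 := Rmax_l _ _); easy.
  - intros x Hx; assert (Hpx := Rpower_pos x alpha).
    destruct (Rlt_le_dec x (d / 2)) as [Hlt|Hge].
    + assert (Hq : c <= V x / Rpower x alpha) by (apply Hd1; [apply Rabs_lt_between'; lra|lra]).
      apply Rle_div_r in Hq; [|easy]; nra.
    + assert (m <= V x) by (apply HmV; lra).
      assert (Rpower x alpha <= 1) by (apply Rpower_le_1; lra); nra.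
  - intros x Hx; assert (Hpx := Rpower_pos (1 - x) alpha).
    destruct (Rlt_le_dec (1 - x) (d / 2)) as [Hlt|Hge].
    + assert (Hq : c' <= V x / Rpower (1 - x) alpha')
        by (apply Hd3; [apply Rabs_lt_between'; lra|lra]).
      apply Rle_div_r in Hq; [|apply Rpower_pos].
      assert (Rpower (1 - x) alpha <= Rpower (1 - x) alpha')
        by (apply Rpower_antitone_exp; lra); nra.
    + assert (m <= V x) by (apply HmV; lra).
      assert (Rpower (1 - x) alpha <= 1) by (apply Rpower_le_1; lra); nra.
  - intros x Hx; assert (Hpx := Rpower_pos x alpha).
    destruct (Rlt_le_dec x (d / 2)) as [Hlt|Hge].
    + assert (Hq : V x / Rpower x alpha <= C)
        by (apply Hd2; [apply Rabs_lt_between'; destruct Hx; lra|apply Hx]).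
      apply Rle_div_l in Hq; [|easy].
      pose proof (Rmax_l C (M / Rpower (d / 2) alpha)); nra.
    + apply Rle_trans with M; [now apply HMV|].
      assert (HMe : M = M / Rpower (d / 2) alpha * Rpower (d / 2) alpha) by (field; lra).
      rewrite HMe at 1.
      assert (0 < M / Rpower (d / 2) alpha) by now apply Rdiv_lt_0_compat.
      apply Rmult_le_compat; [lra|lra|apply Rmax_r|].
      apply Rle_Rpower_l; lra.
Qed.

(** * The upper bound *)


Lemma RInt_ge_increment (f F df : R -> R) (a b : R) :
  a <= b -> ex_RInt f a b ->
  (forall x, a <= x <= b -> is_derive F x (df x) /\ continuous df x) ->
  (forall x, a < x < b -> df x <= f x) -> F b - F a <= RInt f a b.
Proof.
  intros Hab Hf HF Hle.
  assert (Hdf : is_RInt df a b (F b - F a)).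
  { apply (is_RInt_derive F df a b); rewrite Rmin_left, Rmax_right by lra;
      intros x Hx; now apply HF. }
  rewrite <- (is_RInt_unique _ _ _ _ Hdf).
  apply RInt_le; try easy; now exists (F b - F a).
Qed.

Lemma RInt_le_increment (f F df : R -> R) (a b : R) :
  a <= b -> ex_RInt f a b ->
  (forall x, a <= x <= b -> is_derive F x (df x) /\ continuous df x) ->
  (forall x, a < x < b -> f x <= df x) -> RInt f a b <= F b - F a.
Proof.
  intros Hab Hf HF Hle.
  assert (Hdf : is_RInt df a b (F b - F a)).
  { apply (is_RInt_derive F df a b); rewrite Rmin_left, Rmax_right by lra;
      intros x Hx; now apply HF. }
  rewrite <- (is_RInt_unique _ _ _ _ Hdf).
  apply RInt_le; try easy; now exists (F b - F a).
Qed.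

Lemma derive2_at_plus (p q : R -> R) (x p2 q2 : R) :
  derive2_at p x p2 -> derive2_at q x q2 -> derive2_at (fun y => p y + q y) x (p2 + q2).
Proof.
  intros [p' [Hp Hp']] [q' [Hq Hq']]; exists (fun y => p' y + q' y); split.
  - apply filter_imp with (2 := filter_and _ _ Hp Hq); intros y [Hy1 Hy2].
    now apply (is_derive_plus p q).
  - now apply (is_derive_plus p' q').
Qed.

(** The layer function [h] is replaced by an inverse square at each end: the curvature of
    [s^2 / (2 * x^2)] is a multiple of [x^-2] times itself, so it suffices that [gamma * V]
    dominates [x^-2]. *)
Lemma derive2_at_layer (s x : R) :
  in_D x ->
  derive2_at (fun y => 1 - / 2 * (s / y) ^ 2 - / 2 * (s / (1 - y)) ^ 2) x
    (- 3 * s ^ 2 * ((/ x ^ 2) ^ 2 + (/ (1 - x) ^ 2) ^ 2)).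
Proof.
  intros Hx; exists (fun y => s ^ 2 * / y ^ 3 - s ^ 2 * / (1 - y) ^ 3); split.
  - apply filter_imp with (2 := locally_in_D x Hx); intros y [Hy0 Hy1].
    auto_derive; [repeat split; lra|field; lra].
  - destruct Hx as [Hx0 Hx1].
    auto_derive; [|field; lra].
    repeat split; repeat apply Rmult_integral_contrapositive_currified; lra.
Qed.

(** The power [y^(-alpha)] is the outer behaviour of [gamma * g]. The factor [1 - s / y] cuts it off
    inside the layer, and [- B * y^2] makes it negative before the midpoint. *)
Lemma derive2_at_bump (alpha s B x : R) :
  in_D x ->
  derive2_at (fun y => Rpower y (- alpha) * (1 - s / y) - B * y ^ 2) x
    (Rpower x (- alpha) * (alpha * (alpha + 1) / x ^ 2
       - (alpha + 1) * (alpha + 2) * (s / x ^ 3)) - 2 * B).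
Proof.
  intros Hx.
  exists (fun y => Rpower y (- alpha) * (- alpha / y + (alpha + 1) * (s / y ^ 2)) - 2 * B * y).
  split.
  - apply filter_imp with (2 := locally_in_D x Hx); intros y [Hy0 Hy1].
    unfold Rpower; auto_derive; [repeat split; lra|field; lra].
  - destruct Hx as [Hx0 Hx1].
    unfold Rpower; auto_derive; [|field; lra].
    repeat split; repeat apply Rmult_integral_contrapositive_currified; lra.
Qed.

(** The defining property of the layer width: at distance [eps] the rate [gamma * x^alpha] equals
    [eps^-2], the size of a second derivative on that scale. *)
Lemma layer_scaling (gamma alpha eps x : R) :
  0 < eps -> 0 < x -> gamma * Rpower eps (alpha + 2) = 1 ->
  gamma * Rpower x alpha = Rpower (x / eps) alpha / eps ^ 2.
Proof.
  intros He Hx Hg.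
  assert (Hx' : x = x / eps * eps) by (field; lra).
  rewrite Hx' at 1; rewrite <- Rpower_mult_distr by (try apply Rdiv_lt_0_compat; lra).
  rewrite Rpower_plus in Hg; replace 2 with (INR 2) in Hg by (simpl; lra).
  rewrite Rpower_pow in Hg by easy.
  assert (He2 : 0 < eps ^ 2) by now apply pow_lt.
  apply Rmult_eq_reg_r with (eps ^ 2); [|lra].
  unfold Rdiv at 2; rewrite (Rmult_assoc _ (/ eps ^ 2)), Rinv_l, Rmult_1_r by lra.
  transitivity (Rpower (x / eps) alpha * (gamma * (Rpower eps alpha * eps ^ 2))); [ring|].
  rewrite Hg; ring.
Qed.

(** With [t = x / eps] the claim reduces to [c1 * t^(alpha+2) >= 6]. The choice of [k] makes
    [t >= 1 + 6 / c1], hence [c1 * t^2 >= 6]. *)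
Lemma layer_potential_ge (gamma alpha eps c1 k v x : R) :
  0 <= alpha -> 0 < eps -> 0 < c1 -> 0 < gamma -> gamma * Rpower eps (alpha + 2) = 1 ->
  2 * (1 + 6 / c1) <= k -> c1 * Rpower x alpha <= v -> k * eps / 2 <= x ->
  6 * / x ^ 2 <= gamma * v.
Proof.
  intros Ha He Hc1 Hg HgA Hk Hv Hx.
  assert (H6 : 0 < 6 / c1) by (apply Rdiv_lt_0_compat; lra).
  assert (Hx0 : 0 < x) by nra.
  assert (Ht : 1 + 6 / c1 <= x / eps) by (apply Rle_div_r; nra).
  apply Rle_trans with (gamma * (c1 * Rpower x alpha));
    [|apply Rmult_le_compat_l; lra].
  replace (gamma * (c1 * Rpower x alpha)) with (c1 * (gamma * Rpower x alpha)) by ring.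
  rewrite (layer_scaling gamma alpha eps x) by easy.
  set (t := x / eps) in *.
  replace x with (t * eps) by (unfold t; field; lra).
  assert (Htp : 1 <= Rpower t alpha) by (apply Rpower_ge_1; lra).
  assert (Ht2 : 6 <= c1 * t ^ 2).
  { assert (6 / c1 * c1 = 6) by (field; lra).
    assert (6 / c1 <= t ^ 2) by nra; nra. }
  assert (Hte : 0 < / (t * eps) ^ 2) by (apply Rinv_0_lt_compat, pow_lt, Rmult_lt_0_compat; lra).
  replace (c1 * (Rpower t alpha / eps ^ 2)) with (c1 * t ^ 2 * Rpower t alpha * / (t * eps) ^ 2)
    by (field; lra).
  apply Rmult_le_compat_r; nra.
Qed.

(** Here [X] and [Y] stand for the inverse squared distances to the two ends and [W] for
    [gamma * V]. The key inequality is [X^2 + Y^2 <= max(X,Y) * (X + Y)]. *)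
Lemma layer_supersolution (s W X Y : R) :
  0 <= X -> 0 <= Y -> 6 * Rmax X Y <= W ->
  3 / 2 * s ^ 2 * (X ^ 2 + Y ^ 2) <= W * (/ 2 * s ^ 2 * (X + Y)).
Proof.
  intros HX HY HW.
  pose proof (Rmax_l X Y); pose proof (Rmax_r X Y).
  assert (X ^ 2 + Y ^ 2 <= Rmax X Y * (X + Y)) by nra.
  assert (0 <= s ^ 2) by nra.
  apply Rle_trans with (6 * Rmax X Y * (/ 2 * s ^ 2 * (X + Y))).
  - nra.
  - apply Rmult_le_compat_r; [|easy].
    apply Rmult_le_pos; lra.
Qed.

(** Multiplication by [eps^(alpha+2) = / gamma] makes every term bounded: [eps <= x] gives
    [eps^(alpha+2) * x^(-alpha) <= x^2], which absorbs the singular curvature because [s <= x], and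
    [V x * x^(-alpha) <= c2]. The term in [alpha * (alpha + 1) / x^2] has the favourable sign. *)
Lemma bump_bound (gamma alpha eps c2 s B v x : R) :
  0 <= alpha -> 0 < eps <= 1 -> 0 < gamma -> 0 < c2 -> 0 <= B ->
  gamma * Rpower eps (alpha + 2) = 1 ->
  eps <= s -> s <= x -> 0 < v <= c2 * Rpower x alpha ->
  Rpower eps (alpha + 2) *
   (- / 2 * (Rpower x (- alpha) * (alpha * (alpha + 1) / x ^ 2
       - (alpha + 1) * (alpha + 2) * (s / x ^ 3)) - 2 * B)
    + gamma * v * (Rpower x (- alpha) * (1 - s / x) - B * x ^ 2)) <=
  (alpha + 1) * (alpha + 2) / 2 + B + c2.
Proof.
  intros Ha He Hg Hc2 HB HgA Hs Hx Hv.
  assert (Hx0 : 0 < x) by lra.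
  assert (HA0 := Rpower_pos eps (alpha + 2)).
  assert (HA1 : Rpower eps (alpha + 2) <= 1) by (apply Rpower_le_1; lra).
  assert (Hq := Rpower_pos x (- alpha)).
  assert (Hqx : Rpower x alpha * Rpower x (- alpha) = 1).
  { rewrite <- Rpower_plus, Rplus_opp_r; now apply Rpower_O. }
  assert (HAq : Rpower eps (alpha + 2) * Rpower x (- alpha) <= x ^ 2).
  { apply Rle_trans with (Rpower x (alpha + 2) * Rpower x (- alpha)).
    - apply Rmult_le_compat_r; [lra|apply Rle_Rpower_l; lra].
    - rewrite <- Rpower_plus; replace (alpha + 2 + - alpha) with (INR 2) by (simpl; ring).
      rewrite Rpower_pow by easy; lra. }
  set (A := Rpower eps (alpha + 2)) in *; set (q := Rpower x (- alpha)) in *.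
  set (r := Rpower x alpha) in *.
  assert (Hsx : s / x <= 1) by (apply Rle_div_l; lra).
  assert (Hsx0 : 0 < s / x) by (apply Rdiv_lt_0_compat; lra).
  assert (H1 : A * q * (s / x ^ 3) <= 1).
  { replace (s / x ^ 3) with (s / x * / x ^ 2) by (field; lra).
    assert (Hx2 : 0 < x ^ 2) by nra.
    apply Rle_trans with (x ^ 2 * (s / x * / x ^ 2)).
    - apply Rmult_le_compat_r; [|easy].
      apply Rmult_le_pos; [lra|left; now apply Rinv_0_lt_compat].
    - replace (x ^ 2 * (s / x * / x ^ 2)) with (s / x) by (field; lra); easy. }
  assert (H2 : 0 <= A * q * (alpha * (alpha + 1) / x ^ 2)).
  { apply Rmult_le_pos; [nra|].
    apply Rmult_le_pos; [nra|left; apply Rinv_0_lt_compat, pow_lt; easy]. }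
  assert (H3 : v * q * (1 - s / x) <= c2).
  { assert (v * q <= c2) by (replace c2 with (c2 * (r * q)) by (rewrite Hqx; ring); nra).
    assert (0 < v * q) by (apply Rmult_lt_0_compat; lra); nra. }
  assert (H4 : 0 <= v * (B * x ^ 2)).
  { apply Rmult_le_pos; [lra|]; apply Rmult_le_pos; [easy|nra]. }
  assert (H5 : A * B <= B) by nra.
  assert (H6 : (alpha + 1) * (alpha + 2) / 2 * (A * q * (s / x ^ 3)) <=
               (alpha + 1) * (alpha + 2) / 2) by nra.
  replace (A * (- / 2 * (q * (alpha * (alpha + 1) / x ^ 2
       - (alpha + 1) * (alpha + 2) * (s / x ^ 3)) - 2 * B)
    + gamma * v * (q * (1 - s / x) - B * x ^ 2))) with
    (- / 2 * (A * q * (alpha * (alpha + 1) / x ^ 2)) +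
      (alpha + 1) * (alpha + 2) / 2 * (A * q * (s / x ^ 3)) + A * B +
      gamma * A * (v * q * (1 - s / x) - v * (B * x ^ 2))) by (field; lra).
  rewrite HgA; lra.
Qed.


Lemma continuous_Rmax_0 (f : R -> R) (x : R) :
  continuous f x -> continuous (fun y => Rmax 0 (f y)) x.
Proof.
  intros Hf.
  apply continuous_ext with (fun y => / 2 * (f y + Rabs (f y))).
  - intros y; unfold Rmax, Rabs; destruct Rle_dec, Rcase_abs; lra.
  - apply (continuous_scal_r (/ 2) (fun y => f y + Rabs (f y))).
    apply (continuous_plus f (fun y => Rabs (f y))); [easy|].
    now apply (continuous_comp f Rabs); [|apply continuous_Rabs].
Qed.

Lemma ex_RInt_scal_continuous_on (u : R -> R) (M a b : R) :
  continuous_on in_Dbar u -> 0 <= a <= b -> b <= 1 -> ex_RInt (fun x => M * u x) a b.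
Proof.
  intros Hu Ha Hb; apply (ex_RInt_scal u), ex_RInt_continuous_on; easy.
Qed.

Lemma RInt_split (f : R -> R) (a b c : R) :
  a <= b <= c -> ex_RInt f a c -> RInt f a c = RInt f a b + RInt f b c.
Proof.
  intros Hb Hf; symmetry.
  apply (RInt_Chasles f); [now apply ex_RInt_Chasles_1 with c|now apply ex_RInt_Chasles_2 with a].
Qed.

Definition layer_prim (s x : R) : R := x + / 2 * s ^ 2 / x - / 2 * s ^ 2 / (1 - x).

Lemma is_derive_layer_prim (s x : R) :
  in_D x ->
  is_derive (layer_prim s) x (1 - / 2 * (s / x) ^ 2 - / 2 * (s / (1 - x)) ^ 2) /\
  continuous (fun y => 1 - / 2 * (s / y) ^ 2 - / 2 * (s / (1 - y)) ^ 2) x.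
Proof.
  intros [Hx0 Hx1]; split.
  - unfold layer_prim; auto_derive; [split; lra|field; lra].
  - apply (ex_derive_continuous (fun y => 1 - / 2 * (s / y) ^ 2 - / 2 * (s / (1 - y)) ^ 2)).
    auto_derive; split; lra.
Qed.

Lemma continuous_Rpower (x a : R) : 0 < x -> continuous (fun y => Rpower y a) x.
Proof.
  intros Hx; apply (ex_derive_continuous (fun y => Rpower y a)).
  eexists; now apply is_derive_Rpower.
Qed.

(** Dropping the two end intervals costs [2 * s], and the two inverse-square tails cost at most
    [s / 2] each. The deficit [3 * s] is what the added multiple of [x^(-alpha)] has to repay. *)
Lemma subsolution_mass (f : R -> R) (alpha s b D : R) :
  0 < s -> 2 * s <= b -> b + s <= 1 -> 0 <= D -> ex_RInt f 0 1 ->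
  (forall x, in_D x -> 0 <= f x) ->
  (forall x, in_D x -> 1 - / 2 * (s / x) ^ 2 - / 2 * (s / (1 - x)) ^ 2 <= f x) ->
  (forall x, 2 * s < x < b ->
     1 - / 2 * (s / x) ^ 2 - / 2 * (s / (1 - x)) ^ 2 + D * Rpower x (- alpha) <= f x) ->
  3 * s <= D * (prim alpha b - prim alpha (2 * s)) ->
  1 <= RInt f 0 1.
Proof.
  intros Hs Hb Hb1 HD Hf Hpos Hlayer Hbump Hmass.
  assert (Hsub : forall a c, 0 <= a <= c -> c <= 1 -> ex_RInt f a c).
  { intros a c Ha Hc; apply (ex_RInt_Chasles_1 (V := R_CompleteNormedModule) f a c 1); [lra|].
    apply (ex_RInt_Chasles_2 (V := R_CompleteNormedModule) f 0 a 1); [lra|easy]. }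
  rewrite (RInt_split f 0 s 1), (RInt_split f s (1 - s) 1), (RInt_split f s (2 * s) (1 - s)),
    (RInt_split f (2 * s) b (1 - s)) by (try apply Hsub; lra).
  assert (H1 : 0 <= RInt f 0 s).
  { apply RInt_ge_0; [lra|apply Hsub; lra|intros x Hx; apply Hpos; split; lra]. }
  assert (H2 : 0 <= RInt f (1 - s) 1).
  { apply RInt_ge_0; [lra|apply Hsub; lra|intros x Hx; apply Hpos; split; lra]. }
  assert (H3 : layer_prim s (2 * s) - layer_prim s s <= RInt f s (2 * s)).
  { apply RInt_ge_increment
      with (df := fun x => 1 - / 2 * (s / x) ^ 2 - / 2 * (s / (1 - x)) ^ 2);
      [lra|apply Hsub; lra| |].
    - intros x Hx; apply is_derive_layer_prim; split; lra.
    - intros x Hx; apply Hlayer; split; lra. }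
  assert (H4 : layer_prim s (1 - s) - layer_prim s b <= RInt f b (1 - s)).
  { apply RInt_ge_increment
      with (df := fun x => 1 - / 2 * (s / x) ^ 2 - / 2 * (s / (1 - x)) ^ 2);
      [lra|apply Hsub; lra| |].
    - intros x Hx; apply is_derive_layer_prim; split; lra.
    - intros x Hx; apply Hlayer; split; lra. }
  assert (H5 : (layer_prim s b + D * prim alpha b) -
               (layer_prim s (2 * s) + D * prim alpha (2 * s)) <= RInt f (2 * s) b).
  { apply RInt_ge_increment with (F := fun x => layer_prim s x + D * prim alpha x)
      (df := fun x => 1 - / 2 * (s / x) ^ 2 - / 2 * (s / (1 - x)) ^ 2 + D * Rpower x (- alpha)).
    - lra.
    - apply Hsub; lra.
    - intros x Hx.
      destruct (is_derive_layer_prim s x) as [Hd Hc]; [split; lra|split].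
      + apply (is_derive_plus (layer_prim s)); [easy|].
        apply (is_derive_scal (prim alpha)), is_derive_prim; lra.
      + apply (continuous_plus (fun x => 1 - / 2 * (s / x) ^ 2 - / 2 * (s / (1 - x)) ^ 2));
          [easy|].
        apply (continuous_scal_r D (fun x => Rpower x (- alpha))), continuous_Rpower; lra.
    - exact Hbump. }
  assert (H6 : 1 - 3 * s <= layer_prim s (1 - s) - layer_prim s s).
  { unfold layer_prim.
    replace (1 - s + / 2 * s ^ 2 / (1 - s) - / 2 * s ^ 2 / (1 - (1 - s)) -
      (s + / 2 * s ^ 2 / s - / 2 * s ^ 2 / (1 - s))) with
      (1 - 3 * s + s ^ 2 * / (1 - s)) by (field; lra).
    assert (0 <= s ^ 2 * / (1 - s)); [|lra].
    apply Rmult_le_pos; [nra|left; apply Rinv_0_lt_compat; lra]. }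
  lra.
Qed.

Lemma eigenvalue_upper_bound (V : R -> R) (alpha c1 c2 : R) :
  0 <= alpha -> 0 < c1 -> 0 < c2 -> (forall x, in_D x -> 0 < V x) ->
  (forall x, 0 < x <= / 2 -> c1 * Rpower x alpha <= V x) ->
  (forall x, / 2 <= x < 1 -> c1 * Rpower (1 - x) alpha <= V x) ->
  (forall x, in_D x -> V x <= c2 * Rpower x alpha) ->
  exists C eps0, 0 < C /\ 0 < eps0 /\
  forall eps gamma lambda u, 0 < eps < eps0 -> gamma * Rpower eps (alpha + 2) = 1 ->
  positive_eigenfunction gamma V lambda u ->
  lambda <= C / (Rpower eps (alpha + 1) * rho alpha eps).
Proof.
  intros Ha Hc1 Hc2 HVpos HVl HVr HVu.
  (* The constants: [k] makes the layer inequality hold from [s / 2 = k * eps / 2] on; [B / 4]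
     equals [x^(-alpha)] at [x = / 2], so the bump is nonpositive from there; [eta] brings the bound
     of [bump_bound] down to [/ 4]; [b] ensures [B * x^2 <= / 4] on [(0, b)], where beyond [2 * s]
     the bump keeps a quarter of [x^(-alpha)]. *)
  set (k := 2 * (1 + 6 / c1)).
  set (B := 4 * Rpower (/ 2) (- alpha)).
  set (eta := / (4 * ((alpha + 1) * (alpha + 2) / 2 + B + c2))).
  set (b := / (4 * B)).
  assert (H6 : 0 < 6 / c1) by (apply Rdiv_lt_0_compat; lra).
  assert (Hk : 2 <= k) by (unfold k; lra).
  assert (HB : 4 <= B).
  { assert (1 <= Rpower (/ 2) (- alpha)); [|unfold B; lra].
    rewrite <- (Rpower_1_base (- alpha)); apply Rpower_opp_antitone; lra. }
  assert (HE : 0 < (alpha + 1) * (alpha + 2) / 2) by nra.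
  assert (Heta : 0 < eta) by (apply Rinv_0_lt_compat; lra).
  assert (Hb0 : 0 < b) by (apply Rinv_0_lt_compat; lra).
  assert (HbB : 4 * B * b = 1) by (unfold b; field; lra).
  assert (Hb1 : b <= / 4) by nra.
  destruct (prim_increment_ge_rho alpha (2 * k) b Ha) as [c [e0 [Hc [He0 Hprim]]]];
    [lra|lra|].
  exists (12 * k / (eta * c)), (Rmin e0 (Rmin (exp (-1)) (b / (2 * k)))).
  split; [apply Rdiv_lt_0_compat; nra|].
  assert (Hbk : 0 < b / (2 * k)) by (apply Rdiv_lt_0_compat; lra).
  split; [repeat apply Rmin_pos; try easy; apply exp_pos|].
  intros eps gamma lambda u [He1 He2] HgA Hu.
  assert (Hee0 : eps < e0) by (apply Rlt_le_trans with (1 := He2), Rmin_l).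
  assert (Hrest := Rlt_le_trans _ _ _ He2 (Rmin_r _ _)).
  assert (Heexp := Rlt_le_trans _ _ _ Hrest (Rmin_l _ _)).
  assert (Heb := Rlt_le_trans _ _ _ Hrest (Rmin_r _ _)).
  apply Rlt_div_r in Heb; [|lra].
  clear He2 Hrest.
  assert (He1' : eps <= 1) by (pose proof exp_m1_lt_1; lra).
  assert (Hrho := rho_pos alpha eps ltac:(lra)).
  specialize (Hprim eps ltac:(lra)).
  set (s := k * eps).
  assert (Hs : 0 < s) by (unfold s; nra).
  assert (Hsb : 2 * s < b) by (unfold s; lra).
  assert (Hes : eps <= s) by (unfold s; nra).
  replace (2 * k * eps) with (2 * s) in Hprim by (unfold s; ring).
  assert (HA := Rpower_pos eps (alpha + 2)).
  set (A := Rpower eps (alpha + 2)) in *.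
  assert (Hg : 0 < gamma) by (apply Rmult_lt_reg_r with (1 := HA); lra).
  set (I := prim alpha b - prim alpha (2 * s)) in *.
  assert (HI : 0 < I) by (apply Rlt_le_trans with (2 := Hprim); nra).
  (* Chosen so that a quarter of the bump's mass, [L * (eta * A) / 4 * I], is exactly the deficit
     [3 * s]. *)
  set (L := 12 * s / (eta * A * I)).
  assert (HetaAI : 0 < eta * A * I) by (repeat apply Rmult_lt_0_compat; easy).
  assert (HL : 0 < L) by (apply Rdiv_lt_0_compat; lra).
  assert (HLI : L * (eta * A * I) = 12 * s) by (unfold L; field; lra).
  apply Rle_trans with L.
  2:{ unfold L, s, A.
      replace (alpha + 2) with (1 + (alpha + 1)) by ring.
      rewrite Rpower_plus, Rpower_1 by easy.
      pose proof (Rpower_pos eps (alpha + 1)) as HP.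
      set (P := Rpower eps (alpha + 1)) in *.
      replace (12 * k / (eta * c) / (P * rho alpha eps)) with
        (12 * (k * eps) * / (eta * (eps * P) * (c * rho alpha eps))) by (field; repeat split; lra).
      apply Rmult_le_compat_l; [unfold s in Hs; lra|].
      apply Rinv_le_contravar.
      - repeat apply Rmult_lt_0_compat; easy.
      - apply Rmult_le_compat_l; [|easy].
        left; repeat apply Rmult_lt_0_compat; easy. }
  clearbody L.
  set (layer := fun y => 1 - / 2 * (s / y) ^ 2 - / 2 * (s / (1 - y)) ^ 2).
  set (bump := fun y => Rpower y (- alpha) * (1 - s / y) - B * y ^ 2).
  set (g := fun y => L * (eta * A) * bump y).
  set (phi := fun y => layer y + Rmax 0 (g y)).
  assert (HLA : 0 < L * (eta * A)) by (repeat apply Rmult_lt_0_compat; easy).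
  assert (Hg0l : forall x, 0 < x <= s -> g x <= 0).
  { intros x Hx; unfold g, bump.
    assert (1 <= s / x) by (apply Rle_div_r; lra).
    pose proof (Rpower_pos x (- alpha)).
    assert (Rpower x (- alpha) * (1 - s / x) - B * x ^ 2 <= 0) by nra.
    nra. }
  assert (Hg0r : forall x, / 2 <= x -> g x <= 0).
  { intros x Hx; unfold g, bump.
    assert (0 < s / x) by (apply Rdiv_lt_0_compat; lra).
    assert (Rpower x (- alpha) <= Rpower (/ 2) (- alpha)) by (apply Rpower_opp_antitone; lra).
    pose proof (Rpower_pos x (- alpha)).
    assert (Rpower x (- alpha) * (1 - s / x) - B * x ^ 2 <= 0); [|nra].
    assert (B * / 4 <= B * x ^ 2) by nra.
    unfold B in *; nra. }
  assert (Hphi_layer : forall x, layer x <= phi x).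
  { intros x; unfold phi; pose proof (Rmax_l 0 (g x)); lra. }
  assert (Hphi_g : forall x, layer x + g x <= phi x).
  { intros x; unfold phi; pose proof (Rmax_r 0 (g x)); lra. }
  assert (Hsq : forall x, 0 <= (s / x) ^ 2) by (intros x; apply pow2_ge_0).
  assert (Hlayer_neg : forall x, in_D x -> x < s / 2 \/ 1 - s / 2 < x -> layer x <= 0).
  { intros x [Hx0 Hx1] Hx; unfold layer.
    pose proof (Hsq x); pose proof (Hsq (1 - x)).
    destruct Hx as [Hx|Hx].
    - assert (2 <= s / x) by (apply Rle_div_r; lra); nra.
    - assert (2 <= s / (1 - x)) by (apply Rle_div_r; lra); nra. }
  apply (barta_upper gamma L lambda (s / 2) (1 - s / 2) V u phi); try easy; try lra.
  - intros x Hx; unfold phi.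
    assert (HxD : in_D x) by (split; lra).
    apply (continuous_plus layer (fun y => Rmax 0 (g y))).
    + now apply (is_derive_layer_prim s x).
    + apply continuous_Rmax_0, (continuous_scal_r (L * (eta * A)) bump).
      now apply (derive2_at_continuous bump x _ (derive2_at_bump alpha s B x HxD)).
  - intros x Hx Hout; unfold phi.
    rewrite Rmax_left.
    + rewrite Rplus_0_r; now apply Hlayer_neg.
    + destruct Hx as [Hx0 Hx1], Hout as [H|H]; [apply Hg0l|apply Hg0r]; lra.
  - exists (/ 2); split; [split; lra|].
    apply Rlt_le_trans with (2 := Hphi_layer _); unfold layer.
    replace (s / (1 - / 2)) with (2 * s) by field.
    replace (s / / 2) with (2 * s) by field; nra.
  - intros M HM Hle; destruct Hu as [[Hcont _] [Hupos _]].
    assert (HRI : RInt (fun x => M * u x) 0 1 = M * RInt u 0 1).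
    { apply (RInt_scal u), ex_RInt_continuous_on; try easy; lra. }
    rewrite <- HRI.
    apply subsolution_mass with alpha s b (L * (eta * A) * / 4); try lra.
    + apply ex_RInt_scal_continuous_on; try easy; lra.
    + intros x Hx; pose proof (Hupos x Hx); nra.
    + intros x Hx; apply Rle_trans with (2 := Hle x Hx), Hphi_layer.
    + intros x Hx; assert (HxD : in_D x) by (split; lra).
      apply Rle_trans with (2 := Hle x HxD), Rle_trans with (2 := Hphi_g x).
      apply Rplus_le_compat_l; unfold g.
      rewrite Rmult_assoc; apply Rmult_le_compat_l; [lra|unfold bump].
      assert (s / x <= / 2) by (apply Rle_div_l; lra).
      assert (1 <= Rpower x (- alpha)).
      { rewrite <- (Rpower_1_base (- alpha)); apply Rpower_opp_antitone; lra. }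
      assert (B * x ^ 2 <= / 4) by nra.
      nra.
    + fold I; replace (L * (eta * A) * / 4 * I) with (/ 4 * (L * (eta * A * I))) by ring.
      rewrite HLI; lra.
  - intros x Hx Hpos.
    assert (HVx := HVpos x Hx).
    assert (Hlay2 := derive2_at_layer s x Hx).
    assert (Hbump2 := derive2_at_bump alpha s B x Hx).
    (* Positivity of [phi] keeps [x] away from the ends, exactly where the potential dominates the
       inverse squared distance. *)
    assert (Hin : s / 2 <= x /\ s / 2 <= 1 - x).
    { split; apply Rnot_lt_le; intros Hlt.
      - assert (layer x <= 0) by (apply Hlayer_neg; [easy|lra]).
        unfold phi in Hpos; rewrite Rmax_left in Hpos; [lra|].
        apply Hg0l; destruct Hx; lra.
      - assert (layer x <= 0) by (apply Hlayer_neg; [easy|lra]).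
        unfold phi in Hpos; rewrite Rmax_left in Hpos; [lra|].
        apply Hg0r; lra. }
    assert (HX : 0 < / x ^ 2) by (apply Rinv_0_lt_compat, pow_lt, Hx).
    assert (HY : 0 < / (1 - x) ^ 2) by (apply Rinv_0_lt_compat, pow_lt; destruct Hx; lra).
    assert (HW : 6 * Rmax (/ x ^ 2) (/ (1 - x) ^ 2) <= gamma * V x).
    { destruct Hx as [Hx0 Hx1]; destruct (Rle_lt_dec x (/ 2)) as [Hh|Hh].
      - rewrite Rmax_left by (apply Rinv_le_contravar; [apply pow_lt|apply pow_incr]; lra).
        apply (layer_potential_ge gamma alpha eps c1 k); try easy; try lra.
        apply HVl; lra.
      - rewrite Rmax_right by (apply Rinv_le_contravar; [apply pow_lt|apply pow_incr]; lra).
        apply (layer_potential_ge gamma alpha eps c1 k); try easy; try lra.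
        apply HVr; lra. }
    assert (Hsuper := layer_supersolution s (gamma * V x) (/ x ^ 2) (/ (1 - x) ^ 2)
      (Rlt_le _ _ HX) (Rlt_le _ _ HY) HW).
    assert (Hlx : layer x - 1 = - (/ 2 * s ^ 2 * (/ x ^ 2 + / (1 - x) ^ 2))).
    { unfold layer; destruct Hx; field; lra. }
    set (l2 := - 3 * s ^ 2 * ((/ x ^ 2) ^ 2 + (/ (1 - x) ^ 2) ^ 2)) in *.
    assert (Hlayer_sub : - / 2 * l2 + gamma * V x * (layer x - 1) <= 0).
    { rewrite Hlx; unfold l2; lra. }
    (* [phi] is the maximum of [layer] and [layer + g], so whichever is active touches it from
       below. With [layer] alone the left side is nonpositive, which is enough as
       [L * phi x > 0]. *)
    destruct (Rle_lt_dec (g x) 0) as [Hgx|Hgx].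
    + exists layer, l2; repeat split; try easy.
      * unfold phi; rewrite Rmax_left by easy; ring.
      * now apply filter_forall.
      * assert (Hpx : phi x = layer x) by (unfold phi; rewrite Rmax_left by easy; ring).
        rewrite Hpx in *; nra.
    + set (b2 := Rpower x (- alpha) * (alpha * (alpha + 1) / x ^ 2
         - (alpha + 1) * (alpha + 2) * (s / x ^ 3)) - 2 * B) in *.
      exists (fun y => layer y + g y), (l2 + L * (eta * A) * b2).
      assert (Hxs : s < x).
      { apply Rnot_le_lt; intros Hn; assert (g x <= 0); [|lra].
        apply Hg0l; destruct Hx; lra. }
      assert (Hxh : x < / 2).
      { apply Rnot_le_lt; intros Hn; assert (g x <= 0); [|lra].
        now apply Hg0r. }
      assert (Hpx : phi x = layer x + g x) by (unfold phi; rewrite Rmax_right; lra).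
      repeat split.
      * apply derive2_at_plus; [easy|now apply derive2_at_scal].
      * easy.
      * now apply filter_forall.
      (* The bump costs at most [L / 4]; where it is active, [s < x < / 2], the layer still leaves
         [phi >= / 4]. *)
      * assert (Hphi4 : / 4 <= phi x).
        { rewrite Hpx; apply Rle_trans with (layer x); [|lra]; unfold layer.
          assert (s / x <= 1) by (apply Rle_div_l; lra).
          assert (0 < s / x) by (apply Rdiv_lt_0_compat; lra).
          assert (s / (1 - x) <= / 2) by (apply Rle_div_l; lra).
          assert (0 < s / (1 - x)) by (apply Rdiv_lt_0_compat; lra).
          nra. }
        assert (Hbb := bump_bound gamma alpha eps c2 s B (V x) x Ha
          ltac:(lra) Hg Hc2 ltac:(lra) HgA Hes ltac:(lra) (conj HVx (HVu x Hx))).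
        fold A in Hbb; fold b2 in Hbb.
        apply (Rmult_le_compat_l eta) in Hbb; [|lra].
        replace (eta * ((alpha + 1) * (alpha + 2) / 2 + B + c2)) with (/ 4) in Hbb
          by (unfold eta; field; lra).
        rewrite Hpx in *.
        apply Rle_trans with (L * / 4); [|apply Rmult_le_compat_l; lra].
        apply (Rmult_le_compat_l L) in Hbb; [|lra].
        unfold g, bump at 1; unfold bump.
        apply Rle_trans with (2 := Hbb).
        apply Rle_trans with ((- / 2 * l2 + gamma * V x * (layer x - 1)) +
          L * (eta * (A * (- / 2 * b2 +
            gamma * V x * (Rpower x (- alpha) * (1 - s / x) - B * x ^ 2))))); [right; ring|lra].
Qed.

(** * The lower bound *)


(* Concave near 0, where [V] degenerates, and of order [y^-alpha] at infinity,
   as the solution of [-g''/2 + gamma V g = 1] is in the layer variable. *)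
Definition profile (alpha y : R) : R := Rpower (1 + y ^ 2) (- (alpha / 2)).

Definition profile2 (alpha y : R) : R :=
  profile alpha y * (alpha * ((alpha + 1) * y ^ 2 - 1) / (1 + y ^ 2) ^ 2).

Lemma derive2_at_profile (alpha a b x : R) :
  derive2_at (fun z => profile alpha (a + b * z)) x (b ^ 2 * profile2 alpha (a + b * x)).
Proof.
  assert (Hp : forall y, 0 < 1 + y ^ 2) by (intros y; nra).
  exists (fun z => b * (profile alpha (a + b * z) * (- alpha * (a + b * z) / (1 + (a + b * z) ^ 2)))).
  split.
  - apply filter_forall; intros z; unfold profile, Rpower.
    assert (H := Hp (a + b * z)); simpl in H.
    auto_derive; [simpl; lra|simpl; field; lra].
  - unfold profile2, profile, Rpower.
    assert (H := Hp (a + b * x)); simpl in H.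
    auto_derive; [simpl; repeat split; lra|simpl; field; lra].
Qed.

Lemma profile_pos (alpha y : R) : 0 < profile alpha y.
Proof. apply Rpower_pos. Qed.

Lemma profile_le_1 (alpha y : R) : 0 <= alpha -> profile alpha y <= 1.
Proof.
  intros Ha; unfold profile.
  apply Rle_trans with (Rpower 1 (- (alpha / 2))); [|rewrite Rpower_1_base; lra].
  pose proof (pow2_ge_0 y); apply Rpower_opp_antitone; lra.
Qed.

(** From [(1 + y)^2 <= 2 * (1 + y^2)]. The right side is integrable in closed form through
    [prim]. *)
Lemma profile_le (alpha y : R) :
  0 <= alpha -> 0 <= y -> profile alpha y <= Rpower 2 (alpha / 2) * Rpower (1 + y) (- alpha).
Proof.
  intros Ha Hy; unfold profile.
  apply Rle_trans with (Rpower (/ 2 * (1 + y) ^ 2) (- (alpha / 2))).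
  - assert (0 < (1 + y) ^ 2) by (apply pow_lt; lra).
    pose proof (pow2_ge_0 (1 - y)); apply Rpower_opp_antitone; [lra|split; nra].
  - right; rewrite <- Rpower_mult_distr by (try apply pow_lt; lra); f_equal.
    + unfold Rpower; rewrite ln_Rinv by lra; f_equal; ring.
    + rewrite <- Rpower_pow, Rpower_mult by lra; f_equal; simpl; field.
Qed.

Lemma profile2_le (alpha y : R) :
  0 <= alpha -> 0 < y -> profile2 alpha y <= alpha * (alpha + 1) / y ^ 2.
Proof.
  intros Ha Hy; unfold profile2.
  assert (Hp := profile_pos alpha y); assert (Hp1 := profile_le_1 alpha y Ha).
  assert (Hy2 : 0 < y ^ 2) by nra.
  assert (H : alpha * ((alpha + 1) * y ^ 2 - 1) / (1 + y ^ 2) ^ 2 <=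
              alpha * (alpha + 1) / y ^ 2).
  { apply Rle_div_l; [nra|].
    replace (alpha * (alpha + 1) / y ^ 2 * (1 + y ^ 2) ^ 2) with
      (alpha * (alpha + 1) * (/ y ^ 2 + 2 + y ^ 2)) by (field; lra).
    assert (0 < / y ^ 2) by now apply Rinv_0_lt_compat.
    nra. }
  assert (0 <= alpha * (alpha + 1) / y ^ 2).
  { apply Rmult_le_pos; [nra|left; now apply Rinv_0_lt_compat]. }
  nra.
Qed.

(** Near 0 the potential is no help but the profile is strictly concave; farther out the profile may
    be convex and the potential must win. The factor [K^(alpha+2)] comes from measuring length in
    units of [K * eps] and can be made as large as needed. *)
Lemma profile_supersolution (alpha c1 : R) :
  0 <= alpha -> 0 < c1 -> exists K c3, 1 <= K /\ 0 < c3 /\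
  forall y, 0 < y ->
  2 * c3 <= - / 2 * profile2 alpha y +
            c1 * Rpower K (alpha + 2) * Rpower y alpha * profile alpha y.
Proof.
  intros [Ha|Ha] Hc1.
  (* For [alpha = 0] the profile is constant and has no concavity, but the potential does not
     degenerate. *)
  2:{ exists 1, (c1 / 2); split; [lra|split; [lra|]]; intros y Hy; rewrite <- Ha.
      unfold profile2, profile.
      replace (- (0 / 2)) with 0 by field.
      rewrite Rpower_1_base, !Rpower_O by nra; right; field; nra. }
  (* The value of [y^2] separating the two regimes: below it [1 - (alpha + 1) * y^2 >= / 2], above
     it [y^alpha >= m] and [y^alpha * profile alpha y >= n], the latter because
     [w / (1 + w) = / (2 * alpha + 3)]. *)
  set (w := / (2 * (alpha + 1))).
  set (m := Rpower w (alpha / 2)).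
  set (n := Rpower (/ (2 * alpha + 3)) (alpha / 2)).
  assert (Hw : 0 < w) by (apply Rinv_0_lt_compat; lra).
  assert (Hw1 : (alpha + 1) * w = / 2) by (unfold w; field; lra).
  assert (Hm : 0 < m) by apply Rpower_pos.
  assert (Hn : 0 < n) by apply Rpower_pos.
  (* Large enough that in the outer regime half of the potential term absorbs the convexity. *)
  set (K := 1 + alpha * (alpha + 1) / (c1 * m)).
  assert (HcK : 0 < alpha * (alpha + 1) / (c1 * m)) by (apply Rdiv_lt_0_compat; nra).
  assert (HKm : alpha * (alpha + 1) <= c1 * K * m).
  { unfold K; replace (c1 * (1 + alpha * (alpha + 1) / (c1 * m)) * m) with
      (c1 * m + alpha * (alpha + 1)) by (field; lra); nra. }
  set (q := Rpower 2 (- (alpha / 2))).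
  assert (Hq : 0 < q) by apply Rpower_pos.
  exists K, (/ 2 * Rmin (alpha / 16 * q) (/ 2 * (c1 * n))).
  assert (HK : 1 <= K) by (unfold K; lra).
  split; [easy|split].
  - apply Rmult_lt_0_compat; [lra|]; apply Rmin_pos; nra.
  - intros y Hy.
    rewrite <- Rmult_assoc, Rinv_r, Rmult_1_l by lra.
    unfold profile2; assert (Hp := profile_pos alpha y).
    assert (Hya := Rpower_pos y alpha).
    assert (HKp : K <= Rpower K (alpha + 2)).
    { rewrite <- (Rpower_1 K) at 1 by lra; apply Rle_Rpower; lra. }
    set (T := c1 * Rpower K (alpha + 2) * Rpower y alpha).
    assert (HT : 0 < T) by (repeat apply Rmult_lt_0_compat; lra).
    replace (- / 2 * (profile alpha y * (alpha * ((alpha + 1) * y ^ 2 - 1) / (1 + y ^ 2) ^ 2)) +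
      T * profile alpha y) with
      (profile alpha y * (/ 2 * (alpha * (1 - (alpha + 1) * y ^ 2) / (1 + y ^ 2) ^ 2) + T))
      by (field; nra).
    assert (Hy2 : 0 < y ^ 2) by nra.
    assert (Hyy : Rpower y alpha = Rpower (y ^ 2) (alpha / 2)).
    { rewrite <- (Rpower_pow 2), Rpower_mult by easy; f_equal; simpl; field. }
    destruct (Rlt_le_dec (y ^ 2) w) as [Hlt|Hge].
    + apply Rle_trans with (1 := Rmin_l _ _).
      assert (Hqp : q <= profile alpha y).
      { unfold q, profile; apply Rpower_opp_antitone; [lra|split; nra]. }
      assert (alpha / 8 <= alpha * (1 - (alpha + 1) * y ^ 2) / (1 + y ^ 2) ^ 2).
      { assert (Hw2 : w <= / 2) by nra.
        assert (0 < (1 + y ^ 2) ^ 2 <= 4) by (split; nra).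
        assert (/ 2 <= 1 - (alpha + 1) * y ^ 2) by nra.
        apply -> Rle_div_r; [|lra].
        replace (alpha / 8 * (1 + y ^ 2) ^ 2) with (alpha * ((1 + y ^ 2) ^ 2 / 8)) by field.
        apply Rmult_le_compat_l; lra. }
      nra.
    + apply Rle_trans with (1 := Rmin_r _ _).
      assert (HTm : alpha * (alpha + 1) <= T).
      { apply Rle_trans with (1 := HKm); unfold T.
        apply Rmult_le_compat; try nra.
        rewrite Hyy; apply Rle_Rpower_l; lra. }
      assert (- (alpha * (alpha + 1)) <= alpha * (1 - (alpha + 1) * y ^ 2) / (1 + y ^ 2) ^ 2).
      { apply Rle_div_r; [nra|].
        assert (0 < alpha * (alpha + 1)) by nra.
        assert (y ^ 2 <= (1 + y ^ 2) ^ 2) by nra.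
        nra. }
      assert (Hnp : n <= Rpower y alpha * profile alpha y).
      { rewrite Hyy; unfold profile.
        replace (Rpower (1 + y ^ 2) (- (alpha / 2))) with (Rpower (/ (1 + y ^ 2)) (alpha / 2))
          by (unfold Rpower; rewrite ln_Rinv by lra; f_equal; ring).
        rewrite Rpower_mult_distr by (try apply Rinv_0_lt_compat; lra).
        apply Rle_Rpower_l; [lra|split; [apply Rinv_0_lt_compat; lra|]].
        apply Rle_div_r; [lra|].
        apply Rmult_le_reg_l with (2 * alpha + 3); [lra|].
        rewrite <- Rmult_assoc, Rinv_r, Rmult_1_l by lra; nra. }
      assert (Hc1n : c1 * n <= T * profile alpha y).
      { unfold T.
        replace (c1 * Rpower K (alpha + 2) * Rpower y alpha * profile alpha y) with
          (c1 * Rpower K (alpha + 2) * (Rpower y alpha * profile alpha y)) by ring.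
        apply Rmult_le_compat; nra. }
      nra.
Qed.

(* [d] is the distance to the nearer endpoint. *)
Lemma profile_pair_supersolution (alpha c1 K c3 eps gamma v d : R) :
  0 <= alpha -> 0 < c1 -> 1 <= K -> 0 < c3 -> 0 < eps <= 1 -> 0 < gamma ->
  gamma * Rpower eps (alpha + 2) = 1 ->
  (forall y, 0 < y ->
    2 * c3 <= - / 2 * profile2 alpha y +
            c1 * Rpower K (alpha + 2) * Rpower y alpha * profile alpha y) ->
  2 * alpha * (alpha + 1) * K ^ 2 * eps <= c3 ->
  0 < d <= / 2 -> c1 * Rpower d alpha <= v ->
  let y := d / (K * eps) in let y' := (1 - d) / (K * eps) in
  c3 <= - / 2 * (profile2 alpha y + profile2 alpha y') +
     gamma * v * (K * eps) ^ 2 * (profile alpha y + profile alpha y').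
Proof.
  intros Ha Hc1 HK Hc3 He Hg HgA Hsup Heps Hd Hv y y'.
  assert (HKe : 0 < K * eps) by nra.
  assert (Hy : 0 < y) by (apply Rdiv_lt_0_compat; lra).
  assert (Hy' : 0 < y') by (apply Rdiv_lt_0_compat; lra).
  assert (H1 := Hsup y Hy).
  assert (H2 := profile2_le alpha y' Ha Hy').
  (* The far end is at distance at least 1/2, so the convexity of its profile is of order [eps^2]
     and uses up at most half of the [2 * c3] gained at the near end. *)
  assert (H3 : alpha * (alpha + 1) / y' ^ 2 <= 2 * c3).
  { assert (/ 2 <= y' * (K * eps)) by (unfold y'; field_simplify; lra).
    assert (/ 4 <= y' ^ 2 * (K ^ 2 * eps)).
    { apply Rle_trans with ((y' * (K * eps)) ^ 2); [nra|].
      replace ((y' * (K * eps)) ^ 2) with (y' ^ 2 * (K ^ 2 * eps) * eps) by ring.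
      assert (0 < y' ^ 2 * (K ^ 2 * eps)) by
        (apply Rmult_lt_0_compat; [apply pow_lt; lra|apply Rmult_lt_0_compat; [apply pow_lt|]; lra]).
      nra. }
    assert (Hy2 : 0 < y' ^ 2) by nra.
    apply Rle_div_l; [easy|].
    assert (0 <= alpha * (alpha + 1)) by nra.
    apply Rle_trans with (alpha * (alpha + 1) * (4 * (y' ^ 2 * (K ^ 2 * eps)))); [nra|].
    replace (alpha * (alpha + 1) * (4 * (y' ^ 2 * (K ^ 2 * eps)))) with
      (2 * (2 * alpha * (alpha + 1) * K ^ 2 * eps) * y' ^ 2) by ring.
    nra. }
  assert (Hp := profile_pos alpha y); assert (Hp' := profile_pos alpha y').
  assert (H4 : c1 * Rpower K (alpha + 2) * Rpower y alpha <= gamma * v * (K * eps) ^ 2).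
  { assert (Hge : gamma * (c1 * Rpower d alpha) <= gamma * v) by (apply Rmult_le_compat_l; lra).
    replace (gamma * (c1 * Rpower d alpha)) with (c1 * (gamma * Rpower d alpha)) in Hge by ring.
    rewrite (layer_scaling gamma alpha eps d) in Hge by (try easy; lra).
    replace (d / eps) with (K * y) in Hge by (unfold y; field; lra).
    rewrite <- Rpower_mult_distr in Hge by lra.
    rewrite Rpower_plus; replace 2 with (INR 2) at 1 by (simpl; lra).
    rewrite Rpower_pow by lra.
    apply (Rmult_le_compat_r ((K * eps) ^ 2)) in Hge; [|apply pow2_ge_0].
    apply Rle_trans with (2 := Hge); right; field; lra. }
  assert (0 <= gamma * v * (K * eps) ^ 2).
  { apply Rle_trans with (2 := H4).
    pose proof (Rpower_pos K (alpha + 2)); pose proof (Rpower_pos y alpha).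
    left; repeat apply Rmult_lt_0_compat; easy. }
  nra.
Qed.

Lemma derive2_at_const (a x : R) : derive2_at (fun _ => a) x 0.
Proof.
  exists (fun _ => 0); split; [apply filter_forall; intros y|]; auto_derive; easy.
Qed.

Lemma derive2_at_cap (r x : R) :
  0 < r -> derive2_at (fun y => / 2 * (1 - y / r) ^ 3) x (3 * (1 - x / r) / r ^ 2).
Proof.
  intros Hr; exists (fun y => - 3 / 2 * (1 - y / r) ^ 2 / r); split.
  - apply filter_forall; intros y; auto_derive; [lra|field; lra].
  - auto_derive; [lra|field; lra].
Qed.

(** The dip from 1 to 4/5 on [(0, r / 4)] saves [M * r / 20], which pays for the two tails. By
    reflection these have equal integrals, hence the factor 2. *)
Lemma supersolution_mass (f : R -> R) (alpha sigma r M D : R) :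
  0 < sigma -> 0 < r -> r <= 1 -> 0 < M -> ex_RInt f 0 1 ->
  (forall x, in_D x ->
     f x <= M * (1 + D * (Rpower (sigma + x) (- alpha) + Rpower (sigma + 1 - x) (- alpha)))) ->
  (forall x, 0 < x < r / 4 ->
     f x <= M * (4 / 5 +
       D * (Rpower (sigma + x) (- alpha) + Rpower (sigma + 1 - x) (- alpha)))) ->
  D * (2 * (prim alpha (sigma + 1) - prim alpha sigma)) <= r / 20 ->
  RInt f 0 1 <= M.
Proof.
  intros Hs Hr Hr1 HM Hf Hall Hnear Hmass.
  assert (Hinc : forall l a b, 0 <= a <= b -> b <= 1 ->
    (forall x, a < x < b -> f x <= M * (l +
       D * (Rpower (sigma + x) (- alpha) + Rpower (sigma + 1 - x) (- alpha)))) ->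
    RInt f a b <= M * (l * b + D * (prim alpha (sigma + b) - prim alpha (sigma + 1 - b))) -
                  M * (l * a + D * (prim alpha (sigma + a) - prim alpha (sigma + 1 - a)))).
  { intros l a b Ha Hb Hle.
    apply RInt_le_increment with
      (F := fun x => M * (l * x + D * (prim alpha (sigma + x) - prim alpha (sigma + 1 - x))))
      (df := fun x => M * (l +
       D * (Rpower (sigma + x) (- alpha) + Rpower (sigma + 1 - x) (- alpha)))).
    - lra.
    - apply (ex_RInt_Chasles_1 (V := R_CompleteNormedModule) f a b 1); [lra|].
      apply (ex_RInt_Chasles_2 (V := R_CompleteNormedModule) f 0 a 1); [lra|easy].
    - intros x Hx; split.
      + apply (is_derive_scal
          (fun x => l * x + D * (prim alpha (sigma + x) - prim alpha (sigma + 1 - x)))).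
        apply (is_derive_plus (fun x => l * x)).
        * auto_derive; [easy|ring].
        * apply (is_derive_scal (fun x => prim alpha (sigma + x) - prim alpha (sigma + 1 - x))).
          replace (Rpower (sigma + x) (- alpha) + Rpower (sigma + 1 - x) (- alpha)) with
            (minus (scal 1 (Rpower (sigma + x) (- alpha)))
                   (scal (-1) (Rpower (sigma + 1 - x) (- alpha))))
            by (unfold minus, plus, opp, scal; simpl; unfold mult; simpl; ring).
          apply (is_derive_minus (fun x => prim alpha (sigma + x))
                                 (fun x => prim alpha (sigma + 1 - x))).
          -- apply (is_derive_comp (prim alpha) (fun x => sigma + x)).
             ++ apply is_derive_prim; lra.
             ++ auto_derive; [easy|ring].
          -- apply (is_derive_comp (prim alpha) (fun x => sigma + 1 - x)).
             ++ apply is_derive_prim; lra.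
             ++ auto_derive; [easy|ring].
      + apply (ex_derive_continuous (fun x => M * (l +
          D * (Rpower (sigma + x) (- alpha) + Rpower (sigma + 1 - x) (- alpha))))).
        unfold Rpower; auto_derive; repeat split; lra.
    - exact Hle. }
  rewrite (RInt_split f 0 (r / 4) 1) by (try easy; lra).
  assert (H1 := Hinc (4 / 5) 0 (r / 4) ltac:(lra) ltac:(lra) Hnear).
  assert (Hfar : forall x, r / 4 < x < 1 -> f x <= M * (1 +
    D * (Rpower (sigma + x) (- alpha) + Rpower (sigma + 1 - x) (- alpha))))
    by (intros x Hx; apply Hall; split; lra).
  assert (H2 := Hinc 1 (r / 4) 1 ltac:(lra) ltac:(lra) Hfar).
  replace (sigma + 0) with sigma in H1 by ring.
  replace (sigma + 1 - 0) with (sigma + 1) in H1 by ring.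
  replace (sigma + 1 - 1) with sigma in H2 by ring.
  apply (Rmult_le_compat_l M) in Hmass; lra.
Qed.

Lemma eigenvalue_lower_bound (V : R -> R) (alpha c1 c2 : R) :
  0 <= alpha -> 0 < c1 -> 0 < c2 -> (forall x, in_D x -> 0 < V x) ->
  (forall x, 0 < x <= / 2 -> c1 * Rpower x alpha <= V x) ->
  (forall x, / 2 <= x < 1 -> c1 * Rpower (1 - x) alpha <= V x) ->
  (forall x, in_D x -> V x <= c2 * Rpower x alpha) ->
  exists c eps0, 0 < c /\ 0 < eps0 /\
  forall eps gamma lambda u, 0 < eps < eps0 -> gamma * Rpower eps (alpha + 2) = 1 ->
  positive_eigenfunction gamma V lambda u ->
  c / (Rpower eps (alpha + 1) * rho alpha eps) <= lambda.
Proof.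
  intros Ha Hc1 Hc2 HVpos HVl HVr HVu.
  destruct (profile_supersolution alpha c1 Ha Hc1) as [K [c3 [HK [Hc3 Hsup]]]].
  destruct (prim_increment_le_rho alpha K Ha HK) as [C1 [HC1 Hprim]].
  (* [P] normalises the corrector so that [- g'' / 2 + gamma * V * g >= 1]. [eta] narrows the dip to
     width [eta * eps], where the curvature of the cap beats [gamma * V <= c2 / eps^2]. *)
  set (P := K ^ 2 / c3).
  set (eta := / (1 + c2)).
  set (C0 := P * (Rpower 2 (alpha / 2) * Rpower K alpha)).
  assert (HP : 0 < P) by (apply Rdiv_lt_0_compat; nra).
  assert (Heta : 0 < eta) by (apply Rinv_0_lt_compat; lra).
  assert (Heta1 : eta * (1 + c2) = 1) by (unfold eta; field; lra).
  assert (Heta2 : eta <= 1) by nra.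
  assert (HC0 : 0 < C0)
    by (apply Rmult_lt_0_compat; [easy|apply Rmult_lt_0_compat; apply Rpower_pos]).
  (* The first entry keeps the mass of the corrector below [r / 20], the second keeps the corrector
     itself at most 1. *)
  set (c := Rmin (eta / (80 * C0 * C1)) (/ (4 * P))).
  assert (HC01 : 0 < 80 * C0 * C1) by (apply Rmult_lt_0_compat; lra).
  assert (Hc : 0 < c).
  { apply Rmin_pos; [apply Rdiv_lt_0_compat; easy|apply Rinv_0_lt_compat; lra]. }
  assert (Hc80 : c * (80 * C0 * C1) <= eta).
  { apply Rle_div_r; [easy|apply Rmin_l]. }
  assert (Hc4 : c * (4 * P) <= 1).
  { apply Rle_div_r; [lra|].
    apply Rle_trans with (1 := Rmin_r _ _); right; field; lra. }
  clearbody c.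
  set (e1 := c3 / (2 * alpha * (alpha + 1) * K ^ 2 + 1)).
  assert (He1pos : 0 < 2 * alpha * (alpha + 1) * K ^ 2 + 1).
  { assert (0 <= 2 * alpha * (alpha + 1) * K ^ 2); [|lra].
    apply Rmult_le_pos; [nra|apply pow2_ge_0]. }
  exists c, (Rmin (exp (-1)) (Rmin (/ K) e1)); split; [easy|split].
  { repeat apply Rmin_pos; [apply exp_pos|apply Rinv_0_lt_compat; lra|].
    now apply Rdiv_lt_0_compat. }
  intros eps gamma lambda u [He1 He2] HgA Hu.
  assert (Heexp := Rlt_le_trans _ _ _ He2 (Rmin_l _ _)).
  assert (Hrest := Rlt_le_trans _ _ _ He2 (Rmin_r _ _)).
  assert (HeK := Rlt_le_trans _ _ _ Hrest (Rmin_l _ _)).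
  assert (Hee1 := Rlt_le_trans _ _ _ Hrest (Rmin_r _ _)).
  clear He2 Hrest.
  assert (HKe1 : K * eps <= 1).
  { apply (Rmult_lt_compat_l K) in HeK; [|lra].
    rewrite Rinv_r in HeK; lra. }
  assert (He3 : 2 * alpha * (alpha + 1) * K ^ 2 * eps <= c3).
  { unfold e1 in Hee1; apply Rlt_div_r in Hee1; [|easy].
    lra. }
  clear Hee1 HeK.
  assert (He1' : eps <= 1) by (pose proof exp_m1_lt_1; lra).
  assert (Hrho := rho_pos alpha eps ltac:(lra)).
  assert (Hrho2 := rho_ge alpha eps ltac:(lra)).
  specialize (Hprim eps ltac:(lra) HKe1).
  assert (HA := Rpower_pos eps (alpha + 2)).
  assert (HA1 := Rpower_pos eps (alpha + 1)).
  assert (HAA : Rpower eps (alpha + 2) = eps * Rpower eps (alpha + 1)).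
  { replace (alpha + 2) with (1 + (alpha + 1)) by ring; now rewrite Rpower_plus, Rpower_1. }
  assert (Heps2 : eps ^ 2 <= Rpower eps (alpha + 1) * rho alpha eps).
  { apply Rle_trans with (Rpower eps (alpha + 1) * Rpower eps (1 - alpha)).
    - rewrite <- Rpower_plus; replace (alpha + 1 + (1 - alpha)) with (INR 2) by (simpl; ring).
      rewrite Rpower_pow by easy; lra.
    - apply Rmult_le_compat_l; lra. }
  assert (Hg : 0 < gamma) by (apply Rmult_lt_reg_r with (1 := HA); lra).
  set (L := c / (Rpower eps (alpha + 1) * rho alpha eps)).
  assert (HL : 0 < L) by (apply Rdiv_lt_0_compat; [easy|now apply Rmult_lt_0_compat]).
  assert (HLc : L * (Rpower eps (alpha + 1) * rho alpha eps) = c) by (unfold L; field; lra).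
  clearbody L.
  set (sigma := K * eps) in *.
  assert (Hsig : 0 < sigma) by (unfold sigma; nra).
  set (r := eta * eps).
  assert (Hr : 0 < r) by (unfold r; nra).
  assert (Hr1 : r <= 1) by (unfold r; nra).
  (* The height 1/2 keeps [phi >= / 2] up to the endpoint, where Barta's principle needs positivity.
     On [(0, r / 4)] the cap is at least [27 / 128 > / 5]. The dip is made at the left end only. *)
  set (h := fun y => / 2 * (1 - y / r) ^ 3).
  set (gl := fun y => profile alpha (0 + / sigma * y)).
  set (gr := fun y => profile alpha (/ sigma + - / sigma * y)).
  set (g := fun y => P * eps ^ 2 * (gl y + gr y)).
  (* The corrector is taken twice: it contributes [2 * L] to the inequality, and [phi <= 2] turns
     this into [L * phi]. *)
  set (phi := fun y => 1 - Rmax 0 (h y) + 2 * L * g y).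
  assert (Hgl : forall x, 0 < gl x <= 1)
    by (intros x; split; [apply profile_pos|now apply profile_le_1]).
  assert (Hgr : forall x, 0 < gr x <= 1)
    by (intros x; split; [apply profile_pos|now apply profile_le_1]).
  assert (Hpe : 0 < P * eps ^ 2) by (apply Rmult_lt_0_compat; [easy|now apply pow_lt]).
  assert (Hg0 : forall x, 0 < g x).
  { intros x; pose proof (Hgl x); pose proof (Hgr x); unfold g.
    apply Rmult_lt_0_compat; lra. }
  assert (HLg : forall x, 2 * L * g x <= 1).
  { intros x; pose proof (Hgl x); pose proof (Hgr x).
    assert (g x <= P * eps ^ 2 * 2) by (apply Rmult_le_compat_l; lra).
    assert (L * eps ^ 2 <= c) by (rewrite <- HLc; apply Rmult_le_compat_l; lra).
    apply Rle_trans with (2 * L * (P * eps ^ 2 * 2)); [apply Rmult_le_compat_l; lra|].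
    replace (2 * L * (P * eps ^ 2 * 2)) with (L * eps ^ 2 * (4 * P)) by ring.
    apply Rle_trans with (2 := Hc4); apply Rmult_le_compat_r; lra. }
  assert (Hh : forall x, 0 <= x -> h x <= / 2).
  { intros x Hx; unfold h.
    assert (0 <= x / r) by (apply Rmult_le_pos; [easy|left; now apply Rinv_0_lt_compat]).
    set (t := x / r) in *.
    assert ((1 - t) ^ 3 <= 1); [|lra].
    destruct (Rle_lt_dec t 1); [|assert (0 < (t - 1) ^ 3) by (apply pow_lt; lra); nra].
    rewrite <- (pow1 3); apply pow_incr; lra. }
  assert (HgA' : forall x, in_D x -> g x <= C0 * Rpower eps (alpha + 2) *
    (Rpower (sigma + x) (- alpha) + Rpower (sigma + 1 - x) (- alpha))).
  { assert (Hone : forall z, 0 <= z -> profile alpha (/ sigma * z) <=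
      Rpower 2 (alpha / 2) * Rpower K alpha * Rpower eps alpha * Rpower (sigma + z) (- alpha)).
    { intros z Hz.
      assert (Hzs : 0 <= / sigma * z)
        by (apply Rmult_le_pos; [left; now apply Rinv_0_lt_compat|easy]).
      apply Rle_trans with (1 := profile_le alpha _ Ha Hzs).
      rewrite (Rmult_assoc (Rpower 2 (alpha / 2))), (Rmult_assoc (Rpower 2 (alpha / 2))).
      apply Rmult_le_compat_l; [left; apply Rpower_pos|right].
      rewrite Rpower_mult_distr by lra; fold sigma.
      replace (1 + / sigma * z) with (/ sigma * (sigma + z)) by (field; lra).
      rewrite <- (Rpower_mult_distr (/ sigma))
        by (try apply Rinv_0_lt_compat; lra).
      f_equal; unfold Rpower; rewrite ln_Rinv by easy; f_equal; ring. }
    intros x [Hx0 Hx1]; unfold g.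
    assert (H1 := Hone x ltac:(lra)); assert (H2 := Hone (1 - x) ltac:(lra)).
    replace (sigma + (1 - x)) with (sigma + 1 - x) in H2 by ring.
    replace (/ sigma * x) with (0 + / sigma * x) in H1 by ring.
    replace (/ sigma * (1 - x)) with (/ sigma + - / sigma * x) in H2 by ring.
    fold (gl x) in H1; fold (gr x) in H2.
    replace (Rpower eps (alpha + 2)) with (Rpower eps alpha * eps ^ 2).
    2:{ rewrite Rpower_plus, <- (Rpower_pow 2) by easy.
        now replace (INR 2) with 2 by (simpl; lra). }
    unfold C0.
    replace (P * (Rpower 2 (alpha / 2) * Rpower K alpha) * (Rpower eps alpha * eps ^ 2) *
      (Rpower (sigma + x) (- alpha) + Rpower (sigma + 1 - x) (- alpha))) with
      (P * eps ^ 2 * (Rpower 2 (alpha / 2) * Rpower K alpha * Rpower eps alpha *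
         Rpower (sigma + x) (- alpha) +
       Rpower 2 (alpha / 2) * Rpower K alpha * Rpower eps alpha *
         Rpower (sigma + 1 - x) (- alpha))) by ring.
    apply Rmult_le_compat_l; lra. }
  assert (Hgl2 : forall x, derive2_at gl x ((/ sigma) ^ 2 * profile2 alpha (0 + / sigma * x)))
    by (intros x; apply derive2_at_profile).
  assert (Hgr2 : forall x,
    derive2_at gr x ((- / sigma) ^ 2 * profile2 alpha (/ sigma + - / sigma * x)))
    by (intros x; apply derive2_at_profile).
  assert (Hg2 : forall x, derive2_at g x (P * eps ^ 2 *
     ((/ sigma) ^ 2 * profile2 alpha (0 + / sigma * x) +
      (- / sigma) ^ 2 * profile2 alpha (/ sigma + - / sigma * x)))).
  { intros x; apply derive2_at_scal, derive2_at_plus; easy. }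
  assert (Hh2 : forall x, derive2_at h x (3 * (1 - x / r) / r ^ 2))
    by (intros x; now apply derive2_at_cap).
  assert (Hphi_half : forall x, 0 <= x -> / 2 <= phi x).
  { intros x Hx; unfold phi.
    assert (Rmax 0 (h x) <= / 2) by (apply Rmax_lub; [lra|now apply Hh]).
    assert (0 < 2 * L * g x) by (apply Rmult_lt_0_compat; [lra|apply Hg0]).
    lra. }
  apply (barta_lower gamma L lambda V u phi Hg HVpos Hu).
  - intros x [Hx0 Hx1]; split; [|assert (H := Hphi_half x Hx0); lra].
    apply (continuous_plus (fun y => 1 - Rmax 0 (h y)) (fun y => 2 * L * g y)).
    + apply (continuous_minus (fun _ => 1) (fun y => Rmax 0 (h y))).
      * apply continuous_const.
      * apply continuous_Rmax_0; now apply derive2_at_continuous with (1 := Hh2 x).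
    + apply (continuous_scal_r (2 * L) g); now apply derive2_at_continuous with (1 := Hg2 x).
  - intros M HM Hle; destruct Hu as [[Hcont _] _].
    apply supersolution_mass with alpha sigma r (2 * L * (C0 * Rpower eps (alpha + 2)));
      try easy.
    + apply ex_RInt_continuous_on; try easy; lra.
    + intros x Hx; apply Rle_trans with (1 := Hle x Hx).
      apply Rmult_le_compat_l; [lra|unfold phi].
      pose proof (Rmax_l 0 (h x)); rewrite (Rmult_assoc (2 * L)).
      assert (2 * L * g x <= 2 * L * (C0 * Rpower eps (alpha + 2) *
         (Rpower (sigma + x) (- alpha) + Rpower (sigma + 1 - x) (- alpha)))); [|lra].
      apply Rmult_le_compat_l; [lra|now apply HgA'].
    + intros x Hx; assert (HxD : in_D x) by (split; lra).
      apply Rle_trans with (1 := Hle x HxD).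
      apply Rmult_le_compat_l; [lra|unfold phi].
      assert (/ 5 <= h x).
      { unfold h; assert (x / r <= / 4) by (apply Rle_div_l; lra).
        assert ((3 / 4) ^ 3 <= (1 - x / r) ^ 3) by (apply pow_incr; lra); lra. }
      pose proof (Rmax_r 0 (h x)); rewrite (Rmult_assoc (2 * L)).
      assert (2 * L * g x <= 2 * L * (C0 * Rpower eps (alpha + 2) *
         (Rpower (sigma + x) (- alpha) + Rpower (sigma + 1 - x) (- alpha)))); [|lra].
      apply Rmult_le_compat_l; [lra|now apply HgA'].
    + rewrite (Rplus_comm sigma 1), HAA.
      apply Rle_trans with (2 * L * (C0 * (eps * Rpower eps (alpha + 1))) *
        (2 * (C1 * rho alpha eps))).
      * apply Rmult_le_compat_l; [|lra].
        left; apply Rmult_lt_0_compat; [lra|].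
        apply Rmult_lt_0_compat; [easy|now apply Rmult_lt_0_compat].
      * replace (2 * L * (C0 * (eps * Rpower eps (alpha + 1))) * (2 * (C1 * rho alpha eps))) with
          (L * (Rpower eps (alpha + 1) * rho alpha eps) * (80 * C0 * C1) * eps / 20) by field.
        rewrite HLc; unfold r; nra.
  - intros x Hx; pose proof Hx as [Hx0 Hx1].
    set (g2 := P * eps ^ 2 * ((/ sigma) ^ 2 * profile2 alpha (0 + / sigma * x) +
      (- / sigma) ^ 2 * profile2 alpha (/ sigma + - / sigma * x))) in *.
    assert (HVx := HVpos x Hx).
    assert (Hsuper : 1 <= - / 2 * g2 + gamma * V x * g x).
    { assert (Hpair : c3 <= - / 2 * (profile2 alpha (0 + / sigma * x) +
          profile2 alpha (/ sigma + - / sigma * x)) +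
          gamma * V x * (K * eps) ^ 2 * (gl x + gr x)).
      { unfold gl, gr.
        replace (0 + / sigma * x) with (x / sigma) by (field; lra).
        replace (/ sigma + - / sigma * x) with ((1 - x) / sigma) by (field; lra).
        destruct (Rle_lt_dec x (/ 2)) as [Hxh|Hxh].
        - apply (profile_pair_supersolution alpha c1 K c3 eps gamma (V x) x); try easy; try lra.
          apply HVl; lra.
        - replace (x / sigma) with ((1 - (1 - x)) / sigma) by (field; lra).
          rewrite (Rplus_comm (profile2 _ _)), (Rplus_comm (profile _ _)).
          apply (profile_pair_supersolution alpha c1 K c3 eps gamma (V x) (1 - x));
            try easy; try lra.
          apply HVr; lra. }
      apply Rmult_le_reg_l with c3; [easy|].
      rewrite Rmult_1_r; apply Rle_trans with (1 := Hpair); right.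
      unfold g2, g, P, sigma; field; split; lra. }
    assert (Hlower : 2 * L * g x <= 1) by apply HLg.
    assert (Hgoal : forall hx h2, hx = Rmax 0 (h x) -> gamma * V x * hx <= / 2 * h2 ->
      L * phi x <= - / 2 * (- h2 + 2 * L * g2) + gamma * V x * (phi x - 1)).
    { intros hx h2 Hhx Hh2x; unfold phi; rewrite <- Hhx.
      assert (0 <= hx) by (rewrite Hhx; apply Rmax_l).
      apply (Rmult_le_compat_l (2 * L)) in Hsuper; [|lra].
      assert (L * (1 - hx + 2 * L * g x) <= L * 2) by (apply Rmult_le_compat_l; lra).
      lra. }
    (* [phi] is the minimum of the expressions with and without the cap, so the active one touches
       it from above. *)
    destruct (Rle_lt_dec (h x) 0) as [Hhx|Hhx].
    + exists (fun y => 1 + 2 * L * g y), (0 + 2 * L * g2); repeat split.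
      * apply (derive2_at_plus (fun _ => 1)); [apply derive2_at_const|now apply derive2_at_scal].
      * unfold phi; rewrite Rmax_left by easy; ring.
      * apply filter_forall; intros y; unfold phi; pose proof (Rmax_l 0 (h y)); lra.
      * replace 0 with (- 0) at 1 by ring.
        apply (Hgoal 0); [now rewrite Rmax_left|lra].
    + set (h2 := 3 * (1 - x / r) / r ^ 2) in *.
      exists (fun y => 1 + (-1 * h y) + 2 * L * g y), (0 + (-1 * h2) + 2 * L * g2); repeat split.
      * apply derive2_at_plus; [|now apply derive2_at_scal].
        apply (derive2_at_plus (fun _ => 1)); [apply derive2_at_const|apply derive2_at_scal, Hh2].
      * unfold phi; rewrite Rmax_right by lra; ring.
      * apply filter_forall; intros y; unfold phi; pose proof (Rmax_r 0 (h y)); lra.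
      * replace (0 + -1 * h2) with (- h2) by ring.
        apply (Hgoal (h x)); [now rewrite Rmax_right by lra|].
        assert (Ht : 0 < 1 - x / r <= 1).
        { split.
          - apply Rnot_le_lt; intros Hn; unfold h in Hhx.
            pose proof (pow2_ge_0 (1 - x / r)).
            assert ((1 - x / r) * (1 - x / r) ^ 2 <= 0) by nra; simpl in *; lra.
          - assert (0 < x / r) by (apply Rdiv_lt_0_compat; lra); lra. }
        assert (Hxr : x <= r).
        { assert (Hxr : x / r <= 1) by lra; apply Rle_div_l in Hxr; lra. }
        (* On the support of the cap [x <= r <= eps], so the rate has not yet exceeded its value at
           the edge of the layer. With [t^3 <= t], the cap's potential term is then a multiple of
           [t / eps^2], like its curvature. *)
        assert (HgV : gamma * V x <= c2 / eps ^ 2).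
        { apply Rle_trans with (gamma * (c2 * Rpower x alpha));
            [apply Rmult_le_compat_l; [lra|now apply HVu]|].
          replace (gamma * (c2 * Rpower x alpha)) with (c2 * (gamma * Rpower x alpha)) by ring.
          rewrite (layer_scaling gamma alpha eps x) by easy.
          unfold Rdiv at 1; rewrite <- Rmult_assoc.
          apply Rmult_le_compat_r; [left; apply Rinv_0_lt_compat, pow_lt; easy|].
          rewrite <- (Rmult_1_r c2) at 2; apply Rmult_le_compat_l; [lra|].
          apply Rpower_le_1; [easy|split; [now apply Rdiv_lt_0_compat|]].
          apply Rle_div_l; [easy|unfold r in Hxr; nra]. }
        unfold h, h2; set (t := 1 - x / r) in *.
        replace (r ^ 2) with (eta ^ 2 * eps ^ 2) by (unfold r; ring).
        assert (Heps : 0 < / eps ^ 2) by (apply Rinv_0_lt_compat, pow_lt; easy).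
        apply Rle_trans with (c2 / eps ^ 2 * (/ 2 * t)).
        -- assert (Hgv0 : 0 <= gamma * V x) by (left; now apply Rmult_lt_0_compat).
           assert (Ht3 : 0 < t ^ 3 <= t).
           { split; [apply pow_lt; lra|].
             assert (t ^ 2 <= 1) by nra; nra. }
           apply Rmult_le_compat; lra.
        -- replace (/ 2 * (3 * t / (eta ^ 2 * eps ^ 2))) with
             (3 * (/ eta) ^ 2 / eps ^ 2 * (/ 2 * t)) by (field; split; lra).
           apply Rmult_le_compat_r; [lra|].
           apply Rmult_le_compat_r; [lra|].
           unfold eta; rewrite Rinv_inv; nra.
Qed.

(** * The rate *)


Lemma layer_width_small (alpha e0 : R) :
  0 <= alpha -> 0 < e0 ->
  exists M, 1 <= M /\ forall gamma, M < gamma -> Rpower gamma (- / (alpha + 2)) < e0.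
Proof.
  intros Ha He0; exists (Rmax 1 (exp (- (alpha + 2) * ln e0))); split; [apply Rmax_l|].
  intros gamma Hg; unfold Rpower.
  assert (Hg1 := Rle_lt_trans _ _ _ (Rmax_l _ _) Hg).
  assert (Hg2 := Rle_lt_trans _ _ _ (Rmax_r _ _) Hg).
  apply ln_increasing in Hg2; [|apply exp_pos]; rewrite ln_exp in Hg2.
  rewrite <- (exp_ln e0 He0); apply exp_increasing.
  assert (Hi : 0 < / (alpha + 2)) by (apply Rinv_0_lt_compat; lra).
  apply (Rmult_lt_compat_l _ _ _ Hi) in Hg2.
  replace (/ (alpha + 2) * (- (alpha + 2) * ln e0)) with (- ln e0) in Hg2 by (field; lra).
  lra.
Qed.

(** For [alpha < 1] the exponent is [(alpha + 1) / (alpha + 2)]; for [alpha > 1] the factor [rho]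
    lowers [alpha + 1] to 2. At [alpha = 1] one has [- ln eps = ln gamma / 3], whence the factor
    3. *)
Lemma rate_in_layer_width (alpha gamma : R) :
  0 <= alpha -> 1 < gamma ->
  let eps := Rpower gamma (- / (alpha + 2)) in
  let target := Rpower gamma (delta alpha) *
       (if Req_EM_T alpha 1 then / ln gamma else 1) in
  0 < target /\
  / (Rpower eps (alpha + 1) * rho alpha eps) =
    (if Req_EM_T alpha 1 then 3 else 1) * target.
Proof.
  intros Ha Hg eps target; unfold target, eps, rho, delta.
  assert (Hl : 0 < ln gamma) by (rewrite <- ln_1; apply ln_increasing; lra).
  rewrite Rpower_mult, ln_Rpower.
  destruct (total_order_T alpha 1) as [[Hlt|Heq]|Hgt].
  - destruct (Req_EM_T alpha 1) as [|_]; [lra|].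
    rewrite Rmin_left by lra; split.
    + rewrite Rmult_1_r; apply Rpower_pos.
    + rewrite 2!Rmult_1_r, Rmult_1_l, <- Rpower_Ropp; f_equal; field; lra.
  - destruct (Req_EM_T alpha 1) as [_|]; [|lra].
    subst alpha; rewrite Rmin_left by lra; split.
    + apply Rmult_lt_0_compat; [apply Rpower_pos|now apply Rinv_0_lt_compat].
    + replace (- / (1 + 2) * (1 + 1)) with (- ((1 + 1) / (1 + 2))) by field.
      rewrite Rpower_Ropp.
      pose proof (Rpower_pos gamma ((1 + 1) / (1 + 2))); field; split; lra.
  - destruct (Req_EM_T alpha 1) as [|_]; [lra|].
    rewrite Rmin_right by lra; split.
    + rewrite Rmult_1_r; apply Rpower_pos.
    + rewrite Rmult_1_r, Rmult_1_l, Rpower_mult, <- Rpower_plus, <- Rpower_Ropp.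
      f_equal; field; lra.
Qed.

Theorem theorem1 (V : R -> R) (alpha alpha' : R) (lambda0 : R -> R)
  (HVcont : continuous_on in_Dbar V)
  (HVpos : forall x, in_D x -> 0 < V x)
  (Halpha : 0 <= alpha' <= alpha)
  (HV0 : asymp (at_right 0) V (fun x => Rpower x alpha))
  (HV1 : asymp (at_left 1) V (fun x => Rpower (1 - x) alpha'))
  (Hlambda0 : forall gamma, 0 < gamma ->
     is_principal_eigenvalue gamma V (lambda0 gamma)) :
  asymp (Rbar_locally p_infty) lambda0
    (fun gamma => Rpower gamma (delta alpha) *
       (if Req_EM_T alpha 1 then / ln gamma else 1)).
Proof.
  destruct (potential_bounds V alpha alpha' HVcont HVpos Halpha HV0 HV1)
    as [c1 [c2 [Hc1 [Hc2 [HVl [HVr HVu]]]]]].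
  assert (Ha : 0 <= alpha) by lra.
  destruct (eigenvalue_upper_bound V alpha c1 c2 Ha Hc1 Hc2 HVpos HVl HVr HVu)
    as [C [e1 [HC [He1 Hupper]]]].
  destruct (eigenvalue_lower_bound V alpha c1 c2 Ha Hc1 Hc2 HVpos HVl HVr HVu)
    as [c [e2 [Hc [He2 Hlower]]]].
  destruct (layer_width_small alpha (Rmin e1 e2) Ha) as [M [HM Hsmall]];
    [now apply Rmin_pos|].
  set (theta := if Req_EM_T alpha 1 then 3 else 1).
  assert (Htheta : 0 < theta) by (unfold theta; destruct Req_EM_T; lra).
  apply (bounds_asymp _ _ _ (c * theta) (C * theta)); [now apply Rmult_lt_0_compat|].
  exists M; intros gamma Hgamma.
  destruct (rate_in_layer_width alpha gamma Ha) as [Ht Hrate]; [lra|].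
  specialize (Hsmall gamma Hgamma).
  set (eps := Rpower gamma (- / (alpha + 2))) in *.
  fold theta in Hrate.
  set (target := Rpower gamma (delta alpha) * _) in *.
  assert (He : 0 < eps) by apply Rpower_pos.
  assert (HgA : gamma * Rpower eps (alpha + 2) = 1).
  { unfold eps; rewrite Rpower_mult.
    replace (- / (alpha + 2) * (alpha + 2)) with (- (1)) by (field; lra).
    rewrite Rpower_Ropp, Rpower_1 by lra; field; lra. }
  destruct (Hlambda0 gamma) as [[u Hu] _]; [lra|].
  assert (HU := Hupper eps gamma (lambda0 gamma) u
    (conj He (Rlt_le_trans _ _ _ Hsmall (Rmin_l _ _))) HgA Hu).
  assert (HL := Hlower eps gamma (lambda0 gamma) u
    (conj He (Rlt_le_trans _ _ _ Hsmall (Rmin_r _ _))) HgA Hu).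
  unfold Rdiv in HU, HL; rewrite Hrate in HU, HL.
  split; [apply (Rle_div_r _ _ target Ht)|apply (Rle_div_l _ _ target Ht)]; lra.
Qed.
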